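(* Let $L$ be a language consisting of relation symbols and unary function symbols equipped with a permutation group $\Gamma_L$ and let $\mathbf A$ be a finite $\Gamma_L$-structure. If $\mathbf A$ lies in a finite orbit of the action of $\Gamma_L$ by relabelling, then there is a finite $\Gamma_L$-structure $\mathbf B$ which is an irreducible structure faithful coherent EPPA-witness for $\mathbf A$. Consequently, the class of all finite $\Gamma_L$-structures has irreducible structure faithful coherent EPPA if every finite $\Gamma_L$-structure lies in a finite orbit of the action of $\Gamma_L$ by relabelling.
   Context: Structures. A language $L$ consists of relation symbols $R$ (of arity $a(R)\ge 1$) and function symbols $F$ (of arity $a(F)\ge 0$; $F$ is unary if $a(F)=1$). $L$ is equipped with a permutation group $\Gamma_L$ if $\Gamma_L$ is a group of permutations of $L$ mapping relation symbols to relation symbols and function symbols to function symbols and preserving arities. A $\Gamma_L$-structure $\mathbf A$ has a finite or countably infinite vertex set $A$, a relation $R_{\mathbf A}\subseteq A^{a(R)}$ for each relation symbol $R\in L$, and a function $F_{\mathbf A}\colon A^{a(F)}\to\mathcal P(A)$ (the power set of $A$) for each function symbol $F\in L$. It is finite if $A$ is finite. Maps. A homomorphism $f\colon\mathbf A\to\mathbf B$ is a pair $f=(f_L,f_A)$ with $f_L\in\Gamma_L$ and $f_A\colon A\to B$ such that, for all $R,F\in L$ and all tuples $\bar x$, $\bar x\in R_{\mathbf A}$ implies $f_A(\bar x)\in f_L(R)_{\mathbf B}$, and $f_A(F_{\mathbf A}(\bar x))\subseteq f_L(F)_{\mathbf B}(f_A(\bar x))$. It is an embedding if $f_A$ is injective,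 the implication is an equivalence and the inclusion is an equality. An isomorphism is an embedding with $f_A$ bijective; an automorphism is an isomorphism of a structure to itself. Maps compose componentwise (language parts and vertex parts). $\mathbf A$ is a substructure of $\mathbf B$ if $A\subseteq B$ and the pair ($\mathrm{id}_L$, inclusion) is an embedding. For an embedding $f\colon\mathbf A\to\mathbf B$, $f(\mathbf A)$ is the substructure of $\mathbf B$ with vertex set $f_A(A)$; for a vertex set $X$, $f(X)=f_A(X)$. Relabelling. For $g\in\Gamma_L$, $g\mathbf A$ is the $\Gamma_L$-structure on the vertex set $A$ with $R_{g\mathbf A}=(g^{-1}(R))_{\mathbf A}$ and $F_{g\mathbf A}=(g^{-1}(F))_{\mathbf A}$; this defines the action of $\Gamma_L$ by relabelling. Irreducibility. Given embeddings $\alpha_i\colon\mathbf A\to\mathbf B_i$ ($i=1,2$), an amalgamation of $\mathbf B_1,\mathbf B_2$ over $\mathbf A$ with respect to $\alpha_1,\alpha_2$ is a structure $\mathbf C$ with embeddings $\beta_i\colon\mathbf B_i\to\mathbf C$ such that $\beta_1\alpha_1=\beta_2\alpha_2$ (including language parts). It is strong if $\beta_1(B_1)\cap\beta_2(B_2)=\beta_1\alpha_1(A)$. A strong amalgamation is free if $C=\beta_1(B_1)\cup\beta_2(B_2)$ and whenever a tuple $\bar x$ of vertices of $\mathbf C$ contains vertices of both $\beta_1(B_1\setminus\alpha_1(A))$ and $\beta_2(B_2\setminus\alpha_2(A))$, then $\bar x$ is in no relation of $\mathbf C$ and $F_{\mathbf C}(\bar x)=\emptyset$ for every $F\in L$ of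 the corresponding arity. A structure is irreducible if it is not a free amalgamation of two of its proper substructures (over a common substructure, with respect to inclusions). EPPA. A partial automorphism of $\mathbf A$ is an isomorphism $f$ between substructures of $\mathbf A$; its language part $f_L\in\Gamma_L$ is part of the data, and $\mathrm{dom}(f)$, $\mathrm{range}(f)$ refer to its vertex part. An automorphism $\theta$ extends $f$ if $\theta$ has the same language part as $f$ and its vertex part extends that of $f$. A finite $\mathbf B$ is an EPPA-witness for a finite $\mathbf A$ if there is an embedding $\psi\colon\mathbf A\to\mathbf B$ such that every partial automorphism of $\psi(\mathbf A)$ extends to an automorphism of $\mathbf B$. It is coherent if moreover (for this $\psi$) one can choose, for each partial automorphism $f$ of $\psi(\mathbf A)$, an automorphism $\hat f$ of $\mathbf B$ extending $f$ so that $\widehat{gf}=\hat g\hat f$ whenever $\mathrm{range}(f)=\mathrm{dom}(g)$. It is irreducible structure faithful if (for this $\psi$) for every irreducible substructure $\mathbf C$ of $\mathbf B$ there is an automorphism $g$ of $\mathbf B$ with $g(C)\subseteq\psi(A)$. A class $\mathcal K$ of finite $\Gamma_L$-structures has EPPA if every $\mathbf A\in\mathcal K$ has an EPPA-witness $\mathbf B\in\mathcal K$; it has irreducible structure faithful coherent EPPA if such $\mathbf B\in\mathcal K$ can always be chosen to be an irreducible structure faithful coherent EPPA-witness. *)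

(* Defs.v *)
From HB Require Import structures.
From mathcomp Require Import all_boot all_classical.

Set Implicit Arguments.
Unset Strict Implicit.
Unset Printing Implicit Defensive.

Local Open Scope classical_set_scope.

Record language := Language {
  rel_sym : Type;
  fun_sym : Type;
  rel_arity : rel_sym -> nat;
  fun_arity : fun_sym -> nat;
  rel_arity_gt0 : forall R, 0 < rel_arity R }.

(** The permutations of a language that preserve the sort (relation or function)
    and the arity of every symbol.  The inverse is part of the data; it is
    determined by the permutation, see [lang_perm_eq]. *)
Record lang_perm (L : language) := LangPerm {
  rel_perm : rel_sym L -> rel_sym L;
  rel_perm_inv : rel_sym L -> rel_sym L;
  fun_perm : fun_sym L -> fun_sym L;
  fun_perm_inv : fun_sym L -> fun_sym L;
  rel_permK : cancel rel_perm rel_perm_inv;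
  rel_perm_invK : cancel rel_perm_inv rel_perm;
  fun_permK : cancel fun_perm fun_perm_inv;
  fun_perm_invK : cancel fun_perm_inv fun_perm;
  rel_perm_arity : forall R, rel_arity (rel_perm R) = rel_arity R;
  fun_perm_arity : forall F, fun_arity (fun_perm F) = fun_arity F }.

Lemma lang_perm_eq (L : language) (g h : lang_perm L) :
  rel_perm g =1 rel_perm h -> fun_perm g =1 fun_perm h -> g = h.
Proof.
case: g => r ri f fi rK riK fK fiK ra fa.
case: h => r' ri' f' fi' rK' riK' fK' fiK' ra' fa' /= /funext rE /funext fE.
subst r' f'.
have riE : ri = ri' by apply/funext => R; rewrite -{1}(riK' R) rK.
have fiE : fi = fi' by apply/funext => F; rewrite -{1}(fiK' F) fK.
by subst ri' fi'; f_equal; apply: Prop_irrelevance.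
Qed.

Section LangPermGroup.
Variable L : language.
Implicit Types g h : lang_perm L.

Definition lang_perm1 : lang_perm L :=
  @LangPerm L id id id id (fun=> erefl) (fun=> erefl) (fun=> erefl)
    (fun=> erefl) (fun=> erefl) (fun=> erefl).

(** Composition, [g] after [h]. *)
Definition lang_permM g h : lang_perm L :=
  @LangPerm L (rel_perm g \o rel_perm h) (rel_perm_inv h \o rel_perm_inv g)
    (fun_perm g \o fun_perm h) (fun_perm_inv h \o fun_perm_inv g)
    (can_comp (@rel_permK L g) (@rel_permK L h))
    (can_comp (@rel_perm_invK L h) (@rel_perm_invK L g))
    (can_comp (@fun_permK L g) (@fun_permK L h))
    (can_comp (@fun_perm_invK L h) (@fun_perm_invK L g))
    (fun R => etrans (rel_perm_arity g _) (rel_perm_arity h R))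
    (fun F => etrans (fun_perm_arity g _) (fun_perm_arity h F)).

Lemma rel_perm_inv_arity g R : rel_arity (rel_perm_inv g R) = rel_arity R.
Proof. by rewrite -(rel_perm_arity g) rel_perm_invK. Qed.

Lemma fun_perm_inv_arity g F : fun_arity (fun_perm_inv g F) = fun_arity F.
Proof. by rewrite -(fun_perm_arity g) fun_perm_invK. Qed.

Definition lang_permV g : lang_perm L :=
  @LangPerm L (rel_perm_inv g) (rel_perm g) (fun_perm_inv g) (fun_perm g)
    (@rel_perm_invK L g) (@rel_permK L g) (@fun_perm_invK L g) (@fun_permK L g)
    (rel_perm_inv_arity g) (fun_perm_inv_arity g).

Lemma lang_permA : associative lang_permM.
Proof. by move=> g h k; apply: lang_perm_eq. Qed.

Lemma lang_perm1g : left_id lang_perm1 lang_permM.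
Proof. by move=> g; apply: lang_perm_eq. Qed.

Lemma lang_permg1 : right_id lang_perm1 lang_permM.
Proof. by move=> g; apply: lang_perm_eq. Qed.

Lemma lang_permVg : left_inverse lang_perm1 lang_permV lang_permM.
Proof. by move=> g; apply: lang_perm_eq => x /=; rewrite ?rel_permK ?fun_permK. Qed.

Lemma lang_permgV : right_inverse lang_perm1 lang_permV lang_permM.
Proof.
by move=> g; apply: lang_perm_eq => x /=; rewrite ?rel_perm_invK ?fun_perm_invK.
Qed.

HB.instance Definition _ := gen_eqMixin (lang_perm L).
HB.instance Definition _ := gen_choiceMixin (lang_perm L).
HB.instance Definition _ := isGroup.Build (lang_perm L)
  lang_permA lang_perm1g lang_permg1 lang_permVg lang_permgV.

End LangPermGroup.

(** Tuples of vertices are sequences.  A relation holds only on sequences whose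
    length is its arity.  A function is only meaningful on sequences of the
    right length; elsewhere its value is the dummy [set0], so that equality of
    structures is not affected by irrelevant values. *)
Record structure_on (L : language) (V : Type) := StructureOn {
  rel_int : rel_sym L -> set (seq V);
  fun_int : fun_sym L -> seq V -> set V;
  rel_int_size : forall R s, rel_int R s -> size s = rel_arity R;
  fun_int_size : forall F s, size s <> fun_arity F -> fun_int F s = set0 }.

Arguments rel_int {L V} _ R _.
Arguments fun_int {L V} _ F _ _.

Record structure (L : language) := Structure {
  vertex :> countType;
  interp :> structure_on L vertex }.

Definition finite_structure (L : language) (A : structure L) : Prop :=
  finite_set [set: A].

Record gmap (L : language) (A B : structure L) := GMap {
  lang_part : lang_perm L;
  vert_part :> A -> B }.

Definition gcomp (L : language) (A B C : structure L)
    (g : gmap B C) (f : gmap A B) : gmap A C :=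
  GMap (lang_part g * lang_part f)%g (g \o f).

Section Maps.
Variables (L : language) (Gam : groupClosed (lang_perm L)).

Definition is_homomorphism (A B : structure L) (f : gmap A B) : Prop :=
  [/\ lang_part f \in Gam,
      forall R s, rel_int A R s -> rel_int B (rel_perm (lang_part f) R) (map f s)
    & forall F s,
        f @` fun_int A F s `<=` fun_int B (fun_perm (lang_part f) F) (map f s)].

Definition is_embedding (A B : structure L) (f : gmap A B) : Prop :=
  [/\ lang_part f \in Gam, injective f,
      forall R s,
        rel_int A R s <-> rel_int B (rel_perm (lang_part f) R) (map f s)
    & forall F s,
        f @` fun_int A F s = fun_int B (fun_perm (lang_part f) F) (map f s)].

Definition is_isomorphism (A B : structure L) (f : gmap A B) : Prop :=
  is_embedding f /\ bijective f.

Definition is_automorphism (A : structure L) (f : gmap A A) : Prop :=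
  is_isomorphism f.

Record embedding (A B : structure L) := Embedding {
  emb_map :> gmap A B;
  embP : is_embedding emb_map }.

End Maps.

Section Substructures.
Variable L : language.

(** A substructure is determined by its vertex set, and the vertex sets that
    occur are exactly those closed under all functions: see [incl_embedding]
    and [range_closed]. *)
Record substructure (B : structure L) := Substructure {
  vset : set B;
  vset_closed : forall F (s : seq B),
    {subset s <= vset} -> fun_int B F s `<=` vset }.

Variables (B : structure L) (D : substructure B).

Lemma map_val_sub (s : seq (vset D)) : {subset map val s <= vset D}.
Proof. by move=> _ /mapP[x _ ->]; exact: valP. Qed.

Program Definition sub_interp : structure_on L (vset D) :=
  @StructureOn L (vset D)
    (fun R => [set s | rel_int B R (map val s)])
    (fun F s => [set x | fun_int B F (map val s) (val x)]) _ _.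
Next Obligation. by move=> R s /rel_int_size; rewrite size_map. Qed.
Next Obligation.
move=> F s sF; apply/seteqP; split=> x //=.
by rewrite fun_int_size// size_map.
Qed.

Definition sub_structure : structure L := Structure sub_interp.

Definition incl : gmap sub_structure B :=
  @GMap L sub_structure B 1%g (fun x : vset D => val x).

End Substructures.

Coercion sub_structure : substructure >-> structure.

Definition incl_sub (L : language) (B : structure L) (D E : substructure B)
    (DE : vset D `<=` vset E) : gmap D E :=
  @GMap L D E 1%g (fun x : vset D => SigSub (mem_set (DE _ (set_valP x)))).

Lemma incl_embedding (L : language) (Gam : groupClosed (lang_perm L))
    (B : structure L) (D : substructure B) : is_embedding Gam (incl D).
Proof.
split=> //=; first exact: gpred1.
- exact: val_inj.
- move=> F s; apply/seteqP; split=> [_ [x Fx <-]//|x Fx].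
  have xD := vset_closed (@map_val_sub _ _ D s) Fx.
  by exists (SigSub (mem_set xD)).
Qed.

Lemma range_closed (L : language) (Gam : groupClosed (lang_perm L))
    (A B : structure L) (f : gmap A B) : is_embedding Gam f ->
  forall F (s : seq B), {subset s <= range f} -> fun_int B F s `<=` range f.
Proof.
move=> [_ _ _ fF] F s sf.
have [t ->] : exists t, s = map f t.
  elim: s sf => [|x s IHs] xsf; first by exists [::].
  have /set_mem[y _ <-] := xsf x (mem_head x s).
  have [|t ->] := IHs; first by move=> z zs; apply: xsf; rewrite in_cons zs orbT.
  by exists (y :: t).
rewrite -(fun_perm_invK (lang_part f) F) -fF => _ [x _ <-].
by exists x.
Qed.

(** The substructure [f(A)] of [B]. *)
Definition image_sub (L : language) (Gam : groupClosed (lang_perm L))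
    (A B : structure L) (f : embedding Gam A B) : substructure B :=
  Substructure (range_closed (embP f)).

Section Relabelling.
Variables (L : language) (V : Type).

Program Definition relabel (g : lang_perm L) (A : structure_on L V) :
    structure_on L V :=
  @StructureOn L V
    (fun R => rel_int A (rel_perm_inv g R))
    (fun F => fun_int A (fun_perm_inv g F)) _ _.
Next Obligation. by move=> g A R s /rel_int_size; rewrite rel_perm_inv_arity. Qed.
Next Obligation.
by move=> g A F s sF; apply: fun_int_size; rewrite fun_perm_inv_arity.
Qed.

Definition relabel_orbit (Gam : groupClosed (lang_perm L))
    (A : structure_on L V) : set (structure_on L V) :=
  [set relabel g A | g in [set g | g \in Gam]].

End Relabelling.

Section Amalgamation.
Variables (L : language) (Gam : groupClosed (lang_perm L)).
Variables (A B1 B2 C : structure L).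
Variables (alpha1 : gmap A B1) (alpha2 : gmap A B2).
Variables (beta1 : gmap B1 C) (beta2 : gmap B2 C).

Definition is_amalgamation : Prop :=
  [/\ is_embedding Gam alpha1 /\ is_embedding Gam alpha2,
      is_embedding Gam beta1 /\ is_embedding Gam beta2
    & gcomp beta1 alpha1 = gcomp beta2 alpha2].

Definition is_strong_amalgamation : Prop :=
  is_amalgamation /\ range beta1 `&` range beta2 = range (gcomp beta1 alpha1).

Definition is_free_amalgamation : Prop :=
  [/\ is_strong_amalgamation,
      [set: C] = range beta1 `|` range beta2
    & forall s : seq C,
        (exists2 x, x \in s & (beta1 @` (~` range alpha1)) x) ->
        (exists2 y, y \in s & (beta2 @` (~` range alpha2)) y) ->
        (forall R, ~ rel_int C R s) /\ (forall F, fun_int C F s = set0)].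

End Amalgamation.

Definition proper_sub (L : language) (C : structure L) (D : substructure C) :=
  vset D <> [set: C].

Definition irreducible (L : language) (Gam : groupClosed (lang_perm L))
    (C : structure L) : Prop :=
  ~ exists (D1 D2 D0 : substructure C)
      (D01 : vset D0 `<=` vset D1) (D02 : vset D0 `<=` vset D2),
      [/\ proper_sub D1, proper_sub D2
        & is_free_amalgamation Gam (incl_sub D01) (incl_sub D02)
            (incl D1) (incl D2)].

Section EPPA.
Variables (L : language) (Gam : groupClosed (lang_perm L)).

(** For [A] a structure, a partial automorphism of [A] with domain [D] and range
    [E] is an isomorphism [f : gmap D E] between substructures of [A]. *)

(** [theta] extends the partial map [f] of the substructure [P] of [B]; the
    vertices of [D] and [E] are vertices of [P], hence the double [val]. *)
Definition extends (B : structure L) (P : substructure B)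
    (D E : substructure P) (f : gmap D E) (theta : gmap B B) : Prop :=
  lang_part theta = lang_part f /\
  forall x : vset D, theta (val (val x)) = val (val (f x)).

Section Witness.
Variables (A B : structure L) (psi : embedding Gam A B).

Definition EPPA_for : Prop :=
  forall (D E : substructure (image_sub psi)) (f : gmap D E),
    is_isomorphism Gam f ->
    exists2 theta : gmap B B, is_automorphism Gam theta & extends f theta.

(** The values of [hat] on maps that are not isomorphisms are irrelevant.  The
    condition [range f = dom g] is expressed by the shared substructure [E]. *)
Definition coherent_EPPA_for : Prop :=
  exists hat : forall D E : substructure (image_sub psi),
      gmap D E -> gmap B B,
    (forall (D E : substructure (image_sub psi)) (f : gmap D E),
       is_isomorphism Gam f ->
       is_automorphism Gam (hat D E f) /\ extends f (hat D E f)) /\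
    (forall (D E H : substructure (image_sub psi)) (f : gmap D E) (g : gmap E H),
       is_isomorphism Gam f -> is_isomorphism Gam g ->
       hat D H (gcomp g f) = gcomp (hat E H g) (hat D E f)).

Definition irreducible_structure_faithful_for : Prop :=
  forall C : substructure B, irreducible Gam C ->
    exists2 g : gmap B B, is_automorphism Gam g & g @` vset C `<=` range psi.

End Witness.

Definition isf_coherent_EPPA_witness (A B : structure L) : Prop :=
  exists psi : embedding Gam A B,
    [/\ EPPA_for psi, coherent_EPPA_for psi
      & irreducible_structure_faithful_for psi].

(** For classes [K] of finite structures. *)
Definition has_isf_coherent_EPPA (K : structure L -> Prop) : Prop :=
  forall A, K A -> exists2 B, K B & isf_coherent_EPPA_witness A B.

End EPPA.

(* Main.v *)
Require Import Defs.
From HB Require Import structures.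
From mathcomp Require Import all_boot all_fingroup all_algebra all_classical.

Set Implicit Arguments.
Unset Strict Implicit.
Unset Printing Implicit Defensive.

(** The witness [B] is assembled from finitely many copies of [A]: it is one
    orbit of points under a finite group, and the whole difficulty is to find a
    group that is rich enough to extend the partial automorphisms of [A] and yet
    so free that copies of [A] overlap only as partial automorphisms dictate.

    Since [A] has a finite orbit under relabelling, the language part of a
    partial automorphism matters only through its image in a finite quotient of
    the permutation group of the language ([finite_orbit_quotient]).  Paired with
    a permutation of the vertices, a language part thus becomes an element of a
    finite group [gT] acting on the finite set [A].  The structure is then
    forgotten: all that is kept of it is, for every set [X] of vertices and every
    [u] in [gT], the bit telling whether [u] restricts on [X] to an isomorphism
    between substructures.  This is the local type of [X].

    The combinatorial core, [clique_cover_exists], concerns a finite group acting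
    on a finite set with such local types.  It yields a finite set of points with
    a copy of [A] in it, a group of permutations of the points, and an invariant
    graph, such that partial automorphisms extend coherently, an element of the
    group that maps a subset of the copy of [A] into the copy preserves its local
    type, and every clique is carried into the copy of [A] by the group.  It is
    obtained in two steps.
    - A vertex [x] receives a valuation, which assigns to each set [Y] of vertices
      an element of a vector space; the group consists of the permutations that
      respect the sums over [Y] of the valuations.  As these sums encode the local
      types, the group cannot identify sets of different types, whereas valuations
      at vertices outside the domain of a partial map leave enough room for
      extending it ([shift_in], [shift_code]).
    - A set [M] of valued vertices is bad if no group element carries it into the
      copy of [A].  Each vertex now also carries a colour for every bad set,
      with one colour fewer than the set has elements.  Two points are adjacent
      if they disagree on every bad set containing both, so that a clique can
      never lie over a bad set, by the pigeonhole principle ([clique_good]), while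
      colour permutations still move a clique onto any other one lying over
      a translate of its support ([clique_lift]).

    Unary functions are put back by taking as vertices of [B] the translates of
    the pairs formed by a point of the copy of [A] and the closure of that point:
    a vertex of [B] thus carries with it the copy of its closure
    ([glued_vertex], [base_map_embedding]).  In an irreducible substructure of
    [B] any two vertices lie in a common translate of [A], for otherwise the
    substructure splits as a free amalgamation ([irreducible_pair]); hence the
    points under an irreducible substructure form a clique, which some group
    element carries into [A] ([glued_faithful]).  Coherence holds because both
    extension steps are functorial ([ext_comp], [shiftM], [clique_lift_comp]). *)

(** * Coherent extension of partial injections *)
Definition perm_of_fun (T : finType) (f : T -> T) : {perm T} :=
  insubd (1%g : {perm T}) (finfun f).

Lemma perm_of_funE (T : finType) (f : T -> T) :
  injective f -> perm_of_fun f =1 f.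
Proof.
move=> f_inj x; rewrite /perm_of_fun -pvalE insubdK ?ffunE//.
by apply/injectiveP => y z; rewrite !ffunE => /f_inj.
Qed.

Section Extension.
Variable T : finType.
Implicit Types (X : {set T}) (p q : T -> T).

(** A partial injection is completed by matching the complements of its domain
    and range along their enumerations.  The matching depends on the two
    complements alone, which is what makes it compatible with composition. *)
Definition ext X p z :=
  if z \in X then p z
  else nth z (enum (~: (p @: X))) (index z (enum (~: X))).

Lemma extE X p z : z \in X -> ext X p z = p z.
Proof. by rewrite /ext => ->. Qed.

Lemma index_compl X p z : {in X &, injective p} -> z \notin X ->
  index z (enum (~: X)) < size (enum (~: (p @: X))).
Proof.
move=> pI zX; suff <- : size (enum (~: X)) = size (enum (~: (p @: X))).
  by rewrite index_mem mem_enum inE.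
by rewrite -!cardE [LHS]cardsCs [RHS]cardsCs !finset.setCK card_in_imset.
Qed.

Lemma ext_out X p z : {in X &, injective p} -> z \notin X ->
  ext X p z \notin p @: X.
Proof.
move=> pI zX; rewrite /ext (negPf zX).
by have /(mem_nth z) := index_compl pI zX; rewrite mem_enum inE.
Qed.

Lemma ext_inj X p : {in X &, injective p} -> injective (ext X p).
Proof.
move=> pI y z; have [yX|yX] := boolP (y \in X); have [zX|zX] := boolP (z \in X).
- by rewrite !extE//; apply: pI.
- by move=> E; move: (ext_out pI zX); rewrite -E extE// imset_f.
- by move=> E; move: (ext_out pI yX); rewrite E extE// imset_f.
rewrite /ext (negPf yX) (negPf zX).
rewrite (set_nth_default z) ?index_compl// => /eqP.
rewrite nth_uniq ?index_compl ?enum_uniq// => /eqP E.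
have yC : y \in enum (~: X) by rewrite mem_enum inE.
have zC : z \in enum (~: X) by rewrite mem_enum inE.
by rewrite -(nth_index y yC) -(nth_index y zC) E.
Qed.

Lemma ext_comp X p q z : {in X &, injective p} -> {in p @: X &, injective q} ->
  ext (p @: X) q (ext X p z) = ext X (q \o p) z.
Proof.
move=> pI qI; have [zX|zX] := boolP (z \in X).
  by rewrite [ext X p z]extE// !extE ?imset_f.
have zpX := ext_out pI zX.
rewrite {1}/ext (negPf zpX) /ext (negPf zX) imset_comp.
rewrite index_uniq ?index_compl ?enum_uniq//.
apply: set_nth_default; rewrite -imset_comp index_compl//.
by move=> x y xX yX /= /qI E; apply: pI => //; apply: E; rewrite imset_f.
Qed.

Lemma eq_in_ext X p q : {in X, p =1 q} -> ext X p =1 ext X q.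
Proof. by move=> pq z; rewrite /ext (eq_in_imset pq); case: ifP => // /pq. Qed.

End Extension.

(** * Valuations whose sums encode local types *)
Section Valuations.
Import GRing.Theory.
Variables (gT : finGroupType) (A : finType) (sg : gT -> {perm A}).
Hypothesis sgM : {morph sg : g h / (g * h)%g}.
Variable typ : {set A} -> gT -> bool.

Local Open Scope ring_scope.

Implicit Types (X Y : {set A}) (g u : gT).

Lemma action1 : sg 1%g = 1%g.
Proof. by apply: (mulgI (sg 1)); rewrite -sgM !mulg1. Qed.

Lemma imset_actM g h Y : sg (g * h)%g @: Y = sg h @: (sg g @: Y).
Proof.
by rewrite -imset_comp sgM; apply: eq_imset => x /=; rewrite permM.
Qed.

Lemma preimset_act g Y : sg g @^-1: (sg g @: Y) = Y.
Proof. by apply/setP => x; rewrite inE mem_imset//; apply: perm_inj. Qed.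

Lemma act_preimset g Y : sg g @: (sg g @^-1: Y) = Y.
Proof.
apply/setP => x; rewrite -[x](permKV (sg g)) mem_imset ?inE//.
exact: perm_inj.
Qed.

(** Read [typ X u] as: [u] restricts to an isomorphism on [X].  As a function of
    [u] this is the type of [X], on which the group acts by translation of [u];
    preserving it is the abstract form of being an isomorphism on [X].  In
    [partial_auto] subsets are included because restrictions of a partial
    automorphism have to preserve types too, even on sets that do not carry a
    substructure. *)
Definition type_preserving X g := forall u, typ (sg g @: X) u = typ X (g * u)%g.

Definition partial_auto X g := forall Y, Y \subset X -> type_preserving Y g.

(** The modulus exceeds the number of vertices, so that one can divide by the
    size of any nonempty set of vertices. *)
Definition modulus : nat := s2val (prime_above #|A|).
Definition valuation : finType := {ffun {set A} * gT -> 'F_modulus}.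
Definition valued : finType := (A * valuation)%type.

(** All vertices of the copy of [A] get the same valuation, so that the sum over
    [Y] is [#|Y|] times the type of [Y]. *)
Definition valued_code (x : A) : valued :=
  (x, [ffun Yu : {set A} * gT => (typ Yu.1 Yu.2)%:R]).

Lemma card_modulus Y : Y != finset.set0 -> #|Y|%:R != 0 :> 'F_modulus.
Proof.
rewrite -card_gt0 => Y0; rewrite /modulus; case: prime_above => /= q ltq pq.
rewrite -(dvdn_pcharf (pchar_Fp pq)); apply/negP => /(dvdn_leq Y0).
by rewrite leqNgt (leq_ltn_trans (max_card _) ltq).
Qed.

Definition sum_preserving (h : gT * {perm valued}) :=
  (forall v, (h.2 v).1 = sg h.1 v.1) /\
  forall Y u (c : A -> valuation),
    \sum_(x in Y) (h.2 (x, c x)).2 (sg h.1 @: Y, u) =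
    \sum_(x in Y) c x (Y, (h.1 * u)%g).

Definition valued_set : {set gT * {perm valued}} :=
  [set h | `[< sum_preserving h >]].

Lemma valued_setP h : reflect (sum_preserving h) (h \in valued_set).
Proof. by rewrite inE; apply: asboolP. Qed.

Lemma valued_group_set : group_set valued_set.
Proof.
apply/group_setP; split.
  apply/valued_setP; rewrite /sum_preserving action1.
  split=> [v|Y u c]; rewrite ?perm1//.
  rewrite (_ : [set (1%g : {perm A}) x | x in Y] = Y).
    by apply: eq_bigr => x _; rewrite perm1 /= mul1g.
  by rewrite -[RHS]imset_id; apply: eq_imset => x; rewrite perm1.
move=> h k=> /valued_setP[h1 h2] /valued_setP[k1 k2]; apply/valued_setP.
split=> [v|Y u c] /=; first by rewrite !permM k1 h1 sgM permM.
(* The family of valuations to which [k] is applied, indexed by image vertices. *)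
pose c' y := (h.2 (((sg h.1)^-1)%g y, c (((sg h.1)^-1)%g y))).2.
have hc x : h.2 (x, c x) = (sg h.1 x, c' (sg h.1 x)).
  by rewrite /c' permK [LHS]surjective_pairing h1.
rewrite imset_actM -mulgA -h2; under eq_bigr do rewrite permM hc.
under [RHS]eq_bigr do rewrite hc /=.
rewrite -(big_imset (fun y => (k.2 (y, c' y)).2 _)) /=; last first.
  by move=> ? ? _ _; apply: perm_inj.
by rewrite k2 big_imset// => ? ? _ _; apply: perm_inj.
Qed.
Canonical valued_group := Group valued_group_set.

(** The sums over [X] and over its image are both the type multiplied by [#|X|],
    which is invertible. *)
Lemma valued_code_preserved h X x0 : h \in valued_set -> x0 \in X ->
  (forall x, x \in X -> h.2 (valued_code x) = valued_code (sg h.1 x)) ->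
  type_preserving X h.1.
Proof.
move=> /valued_setP[_ h2] Xx0 hX u.
have := h2 X u (fun=> (valued_code x0).2) => /=.
under eq_bigr => x xX do rewrite (hX x xX) ffunE /=.
under [RHS]eq_bigr do rewrite ffunE /=.
rewrite !sumr_const => E; have X0 : X != finset.set0 by apply/set0Pn; exists x0.
move: E (card_modulus X0).
case: (typ _ u); case: (typ X _) => //; rewrite /= mulr0n mulr1n mul0rn.
  by move=> ->; rewrite eqxx.
by move=> <-; rewrite eqxx.
Qed.

(** The failure of [g] to preserve the type of [Y]. *)
Definition defect g Y u : 'F_modulus :=
  (typ (sg g @: Y) u)%:R - (typ Y (g * u)%g)%:R.

(** A group element over [g] that maps the copy of [X] into the copy of [A] must
    add the full defect to the valuations at vertices of [X].  The remaining
    vertices of [Y] compensate in equal shares; sharing equally, rather than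
    choosing a vertex, is what makes the extension coherent. *)
Definition weight X Y x : 'F_modulus :=
  if x \in X then 1 else - (#|Y :&: X|%:R / #|Y :\: X|%:R).

Definition shift_fun X g (v : valued) : valued :=
  (sg g v.1, [ffun Yu : {set A} * gT =>
     let Y := sg g @^-1: Yu.1 in
     v.2 (Y, (g * Yu.2)%g) + weight X Y v.1 * defect g Y Yu.2]).

Definition shift X g : {perm valued} := perm_of_fun (shift_fun X g).

Lemma shift_fun_inj X g : injective (shift_fun X g).
Proof.
move=> [x c] [y d] [/perm_inj <-] /ffunP E; congr pair; apply/ffunP => -[Y u].
have := E (sg g @: Y, (g^-1 * u)%g); rewrite !ffunE /= preimset_act mulKVg.
by move/addIr.
Qed.

Lemma shiftE X g : shift X g =1 shift_fun X g.
Proof. exact: perm_of_funE (@shift_fun_inj X g). Qed.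

Lemma sum_weight X Y : ~~ (Y \subset X) -> \sum_(x in Y) weight X Y x = 0.
Proof.
move=> YX; rewrite (big_setID X) /=.
rewrite (eq_bigr (fun=> 1)); last first.
  by move=> x /setIP[_ xX]; rewrite /weight xX.
rewrite sumr_const [X in _ + X](eq_bigr (fun=> - (#|Y :&: X|%:R / #|Y :\: X|%:R))).
  rewrite sumr_const -[X in _ + X]mulr_natr mulNr divfK ?subrr//.
  by apply: card_modulus; rewrite finset.setD_eq0.
by move=> x /setDP[_ xX]; rewrite /weight (negPf xX).
Qed.

(** If [Y] is contained in [X] nothing can compensate the defect, but then it
    vanishes because [g] preserves the type of [Y]. *)
Lemma shift_in X g : partial_auto X g -> (g, shift X g) \in valued_set.
Proof.
move=> gX; apply/valued_setP; split=> [v|Y u c] /=.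
  by rewrite shiftE.
under eq_bigr do rewrite shiftE ffunE /= preimset_act.
rewrite big_split /= -mulr_suml; have [YX|/sum_weight ->] := boolP (Y \subset X).
  by rewrite /defect gX// subrr mulr0 addr0.
by rewrite mul0r addr0.
Qed.

Lemma shift_code X g x : x \in X ->
  shift X g (valued_code x) = valued_code (sg g x).
Proof.
move=> xX; rewrite shiftE; congr pair; apply/ffunP => -[Y u].
by rewrite !ffunE /= /weight xX mul1r /defect act_preimset addrC ffunE subrK.
Qed.

(** The defects of [g] and [h] add up to the defect of the product, and the
    weights are invariant under translation. *)
Lemma shiftM X g h : shift X (g * h)%g = (shift X g * shift (sg g @: X) h)%g.
Proof.
apply/permP => v; rewrite permM !shiftE /shift_fun /= sgM permM; congr pair.
apply/ffunP => -[Y u]; rewrite !ffunE /=.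
set Z := sg h @^-1: Y; set T := sg g @^-1: Z.
have -> : (sg g * sg h)%g @^-1: Y = T by apply/setP => x; rewrite !inE permM.
have -> : weight (sg g @: X) Z (sg g v.1) = weight X T v.1.
  have gI : injective (sg g) by apply: perm_inj.
  have <- : sg g @: T = Z by rewrite act_preimset.
  have gD : sg g @: T :\: sg g @: X = sg g @: (T :\: X).
    apply/setP => y; rewrite -[y](permKV (sg g)) finset.in_setD !mem_imset//.
    by rewrite finset.in_setD.
  rewrite /weight mem_imset// gD -finset.imsetI; last by move=> ? ? _ _; apply: gI.
  by rewrite !card_imset.
rewrite mulgA -addrA -mulrDr; congr (_ + _ * _).
rewrite /defect imset_actM act_preimset mulgA [RHS]addrC.
by rewrite addrA subrK.
Qed.

End Valuations.

(** * Colourings that turn cliques into translates *)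
Section Colours.
Variables (hT : finGroupType) (T : finType) (sg : hT -> {perm T}).
Hypothesis sgM : {morph sg : g h / (g * h)%g}.
Variables (H : {group hT}) (A0 : {set T}).
Implicit Types (X M : {set T}) (h k : hT).

Definition good M := [exists h in H, sg h @: M \subset A0].

Lemma good_act h M : h \in H -> good (sg h @: M) = good M.
Proof.
move=> hH; apply/exists_inP/exists_inP => -[k kH kM].
  by exists (h * k)%g; rewrite ?groupM// imset_actM.
by exists (h^-1 * k)%g; rewrite ?groupM ?groupV// -imset_actM// mulKVg.
Qed.

Definition colour : finType := 'I_#|T|.+1.
Definition coloured : finType := (T * {ffun {set T} -> colour})%type.

(** All sets share one palette, of which only the first [#|M|.-1] colours count at
    [M].  The last colour is dead at every set; it serves as the default value
    where no colour is needed. *)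
Definition alive M (i : colour) := (i < #|M|.-1)%N.

Lemma alive_max M : ~~ alive M ord_max.
Proof. by rewrite /alive -leqNgt /= (leq_trans (leq_pred _)) ?max_card. Qed.

Lemma alive_act h M i : alive (sg h @: M) i = alive M i.
Proof. by rewrite /alive card_imset//; apply: perm_inj. Qed.

Definition well_coloured (u : coloured) := [forall M,
  if ~~ good M && (u.1 \in M) then alive M (u.2 M) else u.2 M == ord_max].

(** Compatibility of a point with itself amounts to its being well coloured. *)
Definition compatible (u w : coloured) :=
  [&& well_coloured u, well_coloured w &
      (u == w) || ((u.1 != w.1) &&
        [forall M, [&& ~~ good M, u.1 \in M & w.1 \in M] ==> (u.2 M != w.2 M)])].

Lemma compatible_well u w : compatible u w -> well_coloured u.
Proof. by case/and3P. Qed.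

Lemma well_colouredE u M : well_coloured u -> ~~ good M -> u.1 \in M ->
  alive M (u.2 M).
Proof. by move=> /forallP/(_ M) + bM uM; rewrite bM uM. Qed.

Lemma well_coloured_max u M : well_coloured u -> good M || (u.1 \notin M) ->
  u.2 M = ord_max.
Proof.
by move=> /forallP/(_ M); rewrite -negb_and negbK -if_neg => + H1; rewrite H1 => /eqP.
Qed.

Lemma compatible_eq u w M : compatible u w -> ~~ good M -> u.1 \in M ->
  w.1 \in M -> u.2 M = w.2 M -> u = w.
Proof.
case/and3P=> _ _ /orP[/eqP//|/andP[_ /forallP/(_ M)]].
by move=> + bM uM wM uw; rewrite bM uM wM uw eqxx.
Qed.

Lemma compatible_fst u w : compatible u w -> u.1 = w.1 -> u = w.
Proof. by case/and3P=> _ _ /orP[/eqP//|/andP[/negP + _ /eqP]]. Qed.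

(** Over a bad set [M] the members of a clique would have pairwise distinct
    colours among the [#|M|.-1] that are alive at [M]. *)
Lemma clique_good (C : {set coloured}) :
  {in C &, forall u w, compatible u w} -> good (fst @: C).
Proof.
move=> CC; apply: contraT => bM; set M := fst @: C in bM.
have CI : {in C &, injective (fun u : coloured => u.2 M)}.
  move=> u w uC wC; apply: compatible_eq; rewrite ?imset_f//; exact: CC.
have M0 : (0 < #|M|)%N.
  rewrite card_gt0; apply: contra bM => /eqP ->.
  by apply/exists_inP; exists 1%g; rewrite ?group1// imset0 finset.sub0set.
have cM : #|M| = #|C|.
  by rewrite card_in_imset// => u w uC wC; apply: compatible_fst; apply: CC.
suff : (#|[set u.2 M | u : coloured in C]| <= #|M|.-1)%N.
  by rewrite card_in_imset// -cM; case: #|M| M0 => // n _; rewrite ltnn.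
have -> : #|M|.-1 = size (iota 0 #|M|.-1) by rewrite size_iota.
rewrite cardE -(size_map val); apply: uniq_leq_size.
  by rewrite map_inj_uniq ?enum_uniq//; apply: val_inj.
move=> _ /mapP[i + ->]; rewrite mem_enum => /imsetP[u uC ->].
rewrite mem_iota /= add0n; apply: well_colouredE => //.
  by apply: (compatible_well (CC u u uC uC)).
exact: imset_f.
Qed.

Definition coloured_auto (h : hT * {perm coloured}) :=
  [/\ h.1 \in H, forall u, (h.2 u).1 = sg h.1 u.1
    & forall u w, compatible (h.2 u) (h.2 w) = compatible u w].

Definition coloured_set : {set hT * {perm coloured}} :=
  [set h : hT * {perm coloured} | `[< coloured_auto h >]].

Lemma coloured_setP (h : hT * {perm coloured}) :
  reflect (coloured_auto h) (h \in coloured_set).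
Proof. by rewrite inE; apply: asboolP. Qed.

Lemma coloured_group_set : group_set coloured_set.
Proof.
apply/group_setP; split.
  apply/coloured_setP; split=> [|u|u w]; rewrite /= ?group1 ?perm1//.
  by rewrite (action1 sgM : sg (1%g : hT * {perm coloured}).1 = 1%g) perm1.
move=> h k /coloured_setP[h1 h2 h3] /coloured_setP[k1 k2 k3].
apply/coloured_setP; split=> [|u|u w] /=; rewrite ?groupM ?permM//.
  by rewrite k2 h2 sgM permM.
by rewrite k3 h3.
Qed.
Canonical coloured_group := Group coloured_group_set.

Implicit Types s : T -> {ffun {set T} -> colour}.

(** A clique meets each fibre at most once, so it is the graph of a choice of
    colourings over its support. *)
Definition clique_section X s :=
  {in X &, forall x y, compatible (x, s x) (y, s y)}.

(** The partial map on colours at [M] that carries the clique [s] over [X] to the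
    clique [s'] over the image of [X].  Dead colours are part of its domain
    [fixed_colours], so that its completion to a permutation keeps the colours
    that are alive. *)
Definition recolour X s s' h M (i : colour) :=
  if [pick x in X :&: M | s x M == i] is Some x
  then s' (sg h x) (sg h @: M) else i.

Definition fixed_colours X s M :=
  [set s x M | x in X :&: M] :|: [set i | ~~ alive M i].

Definition clique_lift_fun X s s' h (u : coloured) : coloured :=
  (sg h u.1, [ffun N : {set T} => let M := sg h @^-1: N in
                ext (fixed_colours X s M) (recolour X s s' h M) (u.2 M)]).

Definition clique_lift X s s' h : {perm coloured} :=
  perm_of_fun (clique_lift_fun X s s' h).

Section Lift.
Variables (X : {set T}) (s s' : T -> {ffun {set T} -> colour}) (h : hT).
Hypotheses (hH : h \in H) (sX : clique_section X s).
Hypothesis s'X : clique_section (sg h @: X) s'.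

Let F M := fixed_colours X s M.
Let p M := recolour X s s' h M.

Lemma section_max x M : x \in X -> good M || (x \notin M) -> s x M = ord_max.
Proof.
by move=> xX; apply: (@well_coloured_max (x, s x)); exact: compatible_well (sX xX xX).
Qed.

Lemma section_alive x M : x \in X -> ~~ good M -> x \in M -> alive M (s x M).
Proof.
by move=> xX; apply: (@well_colouredE (x, s x)); exact: compatible_well (sX xX xX).
Qed.

Lemma image_max x M : x \in X -> good M || (x \notin M) ->
  s' (sg h x) (sg h @: M) = ord_max.
Proof.
move=> xX; rewrite -(good_act _ hH) => gM.
apply: (@well_coloured_max (sg h x, s' (sg h x))) => /=.
  by apply: compatible_well (s'X _ _); apply: imset_f; exact: xX.
by rewrite mem_imset//; apply: perm_inj.
Qed.

Lemma image_alive x M : x \in X -> ~~ good M -> x \in M ->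
  alive M (s' (sg h x) (sg h @: M)).
Proof.
move=> xX bM xM; rewrite -(alive_act h).
apply: (@well_colouredE (sg h x, s' (sg h x))) => /=; rewrite ?good_act ?imset_f//.
by apply: compatible_well (s'X _ _); apply: imset_f; exact: xX.
Qed.

Lemma recolour_dead M i : ~~ alive M i -> p M i = i.
Proof.
move=> di; rewrite /p /recolour; case: pickP => // x /andP[/setIP[xX xM] /eqP sxi].
have gM : good M by apply: contraNT di => bM; rewrite -sxi section_alive.
by rewrite image_max ?gM// -sxi section_max ?gM.
Qed.

(** If [M] is bad and contains [x], then [x] is determined by its colour at [M]
    within the clique; otherwise the colour is the default one on both sides. *)
Lemma recolour_section M x : x \in X -> p M (s x M) = s' (sg h x) (sg h @: M).
Proof.
move=> xX; have [gM|bM] := boolP (good M || (x \notin M)).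
  by rewrite section_max// recolour_dead ?alive_max// image_max.
move: bM; rewrite negb_or negbK => /andP[bM xM]; rewrite /p /recolour.
case: pickP => [y /andP[/setIP[yX yM] /eqP yx]|/(_ x)]; last first.
  by rewrite inE xX xM eqxx.
by have [-> _] := compatible_eq (sX yX xX) bM yM xM yx.
Qed.

Lemma dead_fixed M i : ~~ alive M i -> i \in F M.
Proof. by move=> di; rewrite /F /fixed_colours inE [_ \in finset _]inE di orbT. Qed.

Lemma section_fixed M x : x \in X -> s x M \in F M.
Proof.
move=> xX; have [gM|] := boolP (good M || (x \notin M)).
  by rewrite section_max// dead_fixed ?alive_max.
rewrite negb_or negbK => /andP[_ xM]; rewrite /F /fixed_colours inE.
by apply/orP; left; apply/imsetP; exists x; rewrite // inE xX.
Qed.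

Lemma fixed_coloursP M i : i \in F M ->
  (~~ alive M i) \/ exists x, [/\ x \in X, x \in M, ~~ good M & i = s x M].
Proof.
case/setUP => [/imsetP[x /setIP[xX xM] ->]|]; last by rewrite inE; left.
have [gM|bM] := boolP (good M).
  by left; rewrite section_max ?gM// alive_max.
by right; exists x.
Qed.

Lemma recolour_alive M i : i \in F M -> alive M (p M i) = alive M i.
Proof.
move=> /fixed_coloursP[di|[x [xX xM bM ->]]]; first by rewrite recolour_dead.
by rewrite recolour_section// image_alive// section_alive.
Qed.

Lemma recolour_inj M : {in F M &, injective (p M)}.
Proof.
move=> i j iF jF E; have := congr1 (alive M) E; rewrite !recolour_alive//.
case: (fixed_coloursP iF) (fixed_coloursP jF) E => [di|[x [xX xM bM ->]]].
  case=> [dj|[y [yX yM bM ->]]]; first by rewrite !recolour_dead.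
  by rewrite (negPf di) section_alive.
case=> [dj|[y [yX yM _ ->]]]; first by rewrite (negPf dj) section_alive.
rewrite !recolour_section// => E _.
have hxy : compatible (sg h x, s' (sg h x)) (sg h y, s' (sg h y)).
  by apply: s'X; apply: imset_f.
have : (sg h x, s' (sg h x)) = (sg h y, s' (sg h y)).
  by apply: (compatible_eq hxy _ _ _ E); rewrite /= ?good_act ?imset_f//.
by case=> /perm_inj ->.
Qed.

(** The images of the domains are the domains needed for the next lift, as
    required for composing completions. *)
Lemma recolour_imset M : p M @: F M = fixed_colours (sg h @: X) s' (sg h @: M).
Proof.
apply/setP/subset_eqP/andP; split; apply/fintype.subsetP => i.
  case/imsetP => j /fixed_coloursP[dj ->|[x [xX xM bM ->]] ->].
    by rewrite recolour_dead// inE [_ \in finset _]inE alive_act dj orbT.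
  rewrite recolour_section// inE; apply/orP; left; apply: imset_f.
  by rewrite inE !imset_f.
rewrite inE => /orP[/imsetP[y /setIP[/imsetP[x xX ->]]]|]; last first.
  rewrite inE alive_act => di; rewrite -[i](recolour_dead di); apply: imset_f.
  exact: dead_fixed.
rewrite mem_imset; last exact: perm_inj.
by move=> xM ->; rewrite -recolour_section// imset_f// section_fixed.
Qed.

Lemma clique_lift_alive M i : alive M (ext (F M) (p M) i) = alive M i.
Proof.
have [iF|iF] := boolP (i \in F M); first by rewrite extE// recolour_alive.
have -> : alive M i by apply: contraNT iF; apply: dead_fixed.
apply: contraT => dj; have := ext_out (@recolour_inj M) iF.
by rewrite recolour_imset inE [_ \in finset _]inE alive_act dj orbT.
Qed.

Lemma clique_lift_fun_inj : injective (clique_lift_fun X s s' h).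
Proof.
move=> [x c] [y d] [/perm_inj <-] /ffunP E; congr pair; apply/ffunP => M.
by have := E (sg h @: M); rewrite !ffunE preimset_act => /(ext_inj (@recolour_inj M)).
Qed.

Lemma clique_liftE : clique_lift X s s' h =1 clique_lift_fun X s s' h.
Proof. exact: perm_of_funE clique_lift_fun_inj. Qed.

Lemma clique_lift_section x : x \in X ->
  clique_lift X s s' h (x, s x) = (sg h x, s' (sg h x)).
Proof.
move=> xX; rewrite clique_liftE; congr pair; apply/ffunP => N; rewrite !ffunE /=.
set M := sg h @^-1: N; have -> : N = sg h @: M by rewrite act_preimset.
by rewrite extE; [exact: recolour_section | exact: section_fixed].
Qed.

Lemma clique_lift_colour u M :
  (clique_lift X s s' h u).2 (sg h @: M) = ext (F M) (p M) (u.2 M).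
Proof. by rewrite clique_liftE ffunE /= preimset_act. Qed.

Lemma clique_lift_well u : well_coloured (clique_lift X s s' h u) = well_coloured u.
Proof.
have fst_lift : (clique_lift X s s' h u).1 = sg h u.1 by rewrite clique_liftE.
have maxE M i : (ext (F M) (p M) i == ord_max) = (i == ord_max).
  have {1}<- : ext (F M) (p M) ord_max = ord_max.
    by rewrite extE ?recolour_dead ?dead_fixed ?alive_max.
  by rewrite (inj_eq (ext_inj (@recolour_inj M))).
apply/forallP/forallP => wu M; last first.
  have /= := wu (sg h @^-1: M); rewrite -[in X in _ -> X](act_preimset sg h M).
  rewrite clique_lift_colour fst_lift good_act// mem_imset; last exact: perm_inj.
  by rewrite alive_act clique_lift_alive maxE.
have := wu (sg h @: M); rewrite clique_lift_colour fst_lift good_act//.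
rewrite mem_imset; last exact: perm_inj.
by rewrite alive_act clique_lift_alive maxE.
Qed.

Lemma clique_lift_compatible u w :
  compatible (clique_lift X s s' h u) (clique_lift X s s' h w) = compatible u w.
Proof.
have fst_lift v : (clique_lift X s s' h v).1 = sg h v.1 by rewrite clique_liftE.
rewrite /compatible !clique_lift_well !fst_lift !(inj_eq perm_inj).
congr [&& _, _ & _ || (_ && _)].
have E M : [&& ~~ good (sg h @: M), sg h u.1 \in sg h @: M & sg h w.1 \in sg h @: M]
    ==> ((clique_lift X s s' h u).2 (sg h @: M) !=
         (clique_lift X s s' h w).2 (sg h @: M)) =
    ([&& ~~ good M, u.1 \in M & w.1 \in M] ==> (u.2 M != w.2 M)).
  rewrite !clique_lift_colour (inj_eq (ext_inj (@recolour_inj M))) good_act//.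
  by rewrite !mem_imset//; apply: perm_inj.
apply/forallP/forallP => A M; first by rewrite -E; apply: A.
by rewrite -(act_preimset sg h M) E; apply: A.
Qed.

Lemma clique_lift_in : (h, clique_lift X s s' h) \in coloured_set.
Proof.
apply/coloured_setP; split=> // [u|]; last exact: clique_lift_compatible.
by rewrite clique_liftE.
Qed.

End Lift.

(** Coherence is inherited at each set [M] from [ext_comp]. *)
Lemma clique_lift_comp X s s' s'' h k : h \in H -> k \in H -> clique_section X s ->
  clique_section (sg h @: X) s' -> clique_section (sg (h * k)%g @: X) s'' ->
  clique_lift X s s'' (h * k)%g =
    (clique_lift X s s' h * clique_lift (sg h @: X) s' s'' k)%g.
Proof.
move=> hH kH sX s'X s''X; have hkH : (h * k)%g \in H by rewrite groupM.
have s''X' : clique_section (sg k @: (sg h @: X)) s'' by rewrite -imset_actM.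
apply/permP => u; rewrite permM !clique_liftE// /clique_lift_fun /= sgM permM.
congr pair.
apply/ffunP => N; rewrite !ffunE /=.
have -> : (sg h * sg k)%g @^-1: N = sg h @^-1: (sg k @^-1: N).
  by apply/setP => x; rewrite !inE permM.
set M := sg h @^-1: (sg k @^-1: N); set i := u.2 M.
have -> : sg k @^-1: N = sg h @: M by rewrite act_preimset.
rewrite -(recolour_imset hH sX s'X) ext_comp.
- apply: eq_in_ext => j /(fixed_coloursP sX)[dj|[x [xX xM _ ->]]] /=.
    by rewrite !recolour_dead// alive_act.
  rewrite !recolour_section// ?imset_f// sgM permM; congr (s'' _ _).
  by rewrite -imset_comp; apply: eq_imset => y /=; rewrite permM.
- exact: recolour_inj.
by rewrite recolour_imset//; apply: recolour_inj.
Qed.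

(** A bad set [M] is not contained in [A0], so the elements of [M :&: A0] can be
    numbered by colours that are alive at [M]. *)
Definition base_colouring (x : T) : {ffun {set T} -> colour} := [ffun M =>
  if ~~ good M && (x \in M) then inord (index x (enum (M :&: A0))) else ord_max].

Lemma base_section : clique_section A0 base_colouring.
Proof.
have iN M x : ~~ good M -> x \in M -> x \in A0 ->
    (index x (enum (M :&: A0)) < #|M|.-1)%N.
  move=> bM xM xA; have : (index x (enum (M :&: A0)) < #|M :&: A0|)%N.
    by rewrite cardE index_mem mem_enum inE xM.
  move/leq_trans; apply; suff : (#|M :&: A0| < #|M|)%N by case: #|M|.
  apply: proper_card; rewrite properE subsetIl /=; apply: contra bM => /subsetIP[_ MA].
  apply/exists_inP; exists 1%g; rewrite ?group1// action1//.
  by rewrite (eq_imset _ (@perm1 _)) imset_id.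
have iE M x : ~~ good M -> x \in M -> x \in A0 ->
    base_colouring x M = index x (enum (M :&: A0)) :> nat.
  move=> bM xM xA; rewrite ffunE bM xM inordK//.
  apply: leq_trans (iN _ _ bM xM xA) _; rewrite (leq_trans (leq_pred _))//.
  by rewrite (leq_trans (max_card _)).
have wc x : x \in A0 -> well_coloured (x, base_colouring x).
  move=> xA; apply/forallP => M /=; case: ifP => [/andP[bM xM]|]; last first.
    by rewrite ffunE => ->.
  by rewrite /alive iE// iN.
move=> x y xA yA; rewrite /compatible !wc//=; case: (eqVneq x y) => [->|xy].
  by rewrite eqxx.
apply/orP; right; apply/forallP => M; apply/implyP => /and3P[bM xM yM].
apply: contraNneq xy => /(congr1 val) /=; rewrite !iE// => E; apply/eqP.
have xC : x \in enum (M :&: A0) by rewrite mem_enum inE xM.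
have yC : y \in enum (M :&: A0) by rewrite mem_enum inE yM.
by rewrite -(nth_index x xC) E nth_index.
Qed.

(** The support of a clique is good, hence translated into [A0] by some [h], and
    lifting [h] carries the clique onto the standard colouring. *)
Lemma clique_translate (C : {set coloured}) :
  {in C &, forall u w, compatible u w} ->
  exists2 h, h \in coloured_set &
    forall u, u \in C -> exists2 x, x \in A0 & h.2 u = (x, base_colouring x).
Proof.
move=> CC; have /exists_inP[h hH hA] := clique_good CC.
(* The default colouring is never reached on the support of [C]. *)
pose s x := if [pick u in C | u.1 == x] is Some u then u.2 else [ffun=> ord_max].
have sC u : u \in C -> s u.1 = u.2.
  rewrite /s => uC; case: pickP => [w /andP[wC /eqP wu]|/(_ u)]; last first.
    by rewrite uC eqxx.
  by rewrite (compatible_fst (CC _ _ wC uC) wu).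
have sX : clique_section (fst @: C) s.
  move=> _ _ /imsetP[u uC ->] /imsetP[w wC ->].
  by rewrite !sC// -!surjective_pairing; apply: CC.
have bX : clique_section (sg h @: (fst @: C)) base_colouring.
  by move=> x y xX yX; apply: base_section; apply: (fintype.subsetP hA).
exists (h, clique_lift (fst @: C) s base_colouring h); first exact: clique_lift_in.
move=> u uC; exists (sg h u.1); first by apply: (fintype.subsetP hA); rewrite !imset_f.
by rewrite [u in LHS]surjective_pairing -sC// clique_lift_section// imset_f.
Qed.

End Colours.

(** * Clique covers *)
Section CliqueCover.
Variables (gT : finGroupType) (A : finType) (sg : gT -> {perm A}).
Hypothesis sgM : {morph sg : g h / (g * h)%g}.
Variable typ : {set A} -> gT -> bool.

Local Notation type_preserving := (type_preserving sg typ).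
Local Notation partial_auto := (partial_auto sg typ).

Implicit Types (X : {set A}) (g k : gT).

(** The points form a set with an invariant graph, acted on by a group over [gT],
    and [cover_base] is a distinguished clique, a copy of [A].
    [cover_type_preserving] says that the group does not identify more of this
    clique than the types allow, and [cover_clique] that up to the group it
    contains all the others. *)
Record clique_cover := CliqueCover {
  cover_group : finGroupType;
  cover_point : finType;
  cover_proj : cover_group -> gT;
  cover_act : cover_group -> {perm cover_point};
  cover_base : A -> cover_point;
  cover_edge : rel cover_point;
  cover_ext : {set A} -> gT -> cover_group;
  cover_projM : {morph cover_proj : g h / (g * h)%g};
  cover_actM : {morph cover_act : g h / (g * h)%g};
  cover_act_base : forall h x y, cover_act h (cover_base x) = cover_base y ->
    y = sg (cover_proj h) x;
  cover_type_preserving : forall h X x0, x0 \in X ->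
    (forall x, x \in X -> exists y, cover_act h (cover_base x) = cover_base y) ->
    type_preserving X (cover_proj h);
  cover_proj_ext : forall X g, partial_auto X g -> cover_proj (cover_ext X g) = g;
  cover_ext_base : forall X g x, partial_auto X g -> x \in X ->
    cover_act (cover_ext X g) (cover_base x) = cover_base (sg g x);
  cover_extM : forall X g k, partial_auto X g -> partial_auto (sg g @: X) k ->
    cover_ext X (g * k)%g = (cover_ext X g * cover_ext (sg g @: X) k)%g;
  cover_edge_act : forall h u w,
    cover_edge (cover_act h u) (cover_act h w) = cover_edge u w;
  cover_edge_base : forall x y, cover_edge (cover_base x) (cover_base y);
  cover_clique : forall C : {set cover_point},
    {in C &, forall u w, cover_edge u w} ->
    exists h, forall u, u \in C -> exists x, cover_act h u = cover_base x }.

Lemma partial_autoM X g k : partial_auto X g -> partial_auto (sg g @: X) k ->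
  partial_auto X (g * k)%g.
Proof.
move=> gX kX Y YX u; rewrite imset_actM// kX ?imsetS//.
by rewrite gX// mulgA.
Qed.

Local Notation valuedT := (valued gT A).
Local Notation vgT := (gT * {perm valuedT})%type.

Let snd_perm (h : vgT) : {perm valuedT} := h.2.
Let snd_permM : {morph snd_perm : g h / (g * h)%g}. Proof. by []. Qed.

Let H := valued_group sgM.
Let A0 := [set valued_code typ x | x : A].
Let K := coloured_group snd_permM H A0.
Let base := base_colouring snd_perm H A0.

Let psi x : coloured valuedT := (valued_code typ x, base (valued_code typ x)).

Let hat1 X g : vgT * {perm coloured valuedT} :=
  ((g, shift sg typ X g),
   clique_lift snd_perm (valued_code typ @: X) base base (g, shift sg typ X g)).

Let section X : clique_section snd_perm H A0 (valued_code typ @: X) base.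
Proof.
have XA : valued_code typ @: X \subset A0.
  by apply/fintype.subsetP => _ /imsetP[x _ ->]; apply: imset_f.
move=> u w /(fintype.subsetP XA) uA /(fintype.subsetP XA) wA.
exact: (base_section snd_permM H).
Qed.

Let shift_imset X g :
  snd_perm (g, shift sg typ X g) @: (valued_code typ @: X) =
    valued_code typ @: (sg g @: X).
Proof.
by rewrite -!imset_comp; apply: eq_in_imset => x xX /=; rewrite /snd_perm shift_code.
Qed.

Let hat1_in X g : partial_auto X g -> hat1 X g \in K.
Proof.
move=> gX; apply: (clique_lift_in snd_permM _ (@section X)); first exact: shift_in.
by rewrite shift_imset.
Qed.

Lemma clique_cover_exists : clique_cover.
Proof.
pose hT := subg_of K.
pose pr (h : hT) := (sgval h).1.1; pose th (h : hT) := (sgval h).2.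
have hK (h : hT) : sgval h \in K by exact: subgP.
have hP h : [/\ (sgval h).1 \in valued_set sg,
    forall u, (th h u).1 = snd_perm (sgval h).1 u.1
    & forall u w, compatible snd_perm H A0 (th h u) (th h w) =
                  compatible snd_perm H A0 u w].
  exact: (coloured_setP _ _ _ _ (hK h)).
have h1 (h : hT) v : ((sgval h).1.2 v).1 = sg (pr h) v.1.
  by have [/valued_setP[] ] := hP h.
have hbase h x y : th h (psi x) = psi y -> y = sg (pr h) x.
  case: (hP h) => _ hu _ E; have := congr1 (fun u : coloured valuedT => u.1.1) E.
  by rewrite hu /= h1.
pose hat X g : hT := subg K (hat1 X g).
have hatE X g : partial_auto X g -> sgval (hat X g) = hat1 X g.
  by move=> gX; rewrite subgK// hat1_in.
refine (@CliqueCover hT (coloured valuedT) pr th psi (compatible snd_perm H A0) hat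
  _ _ hbase _ _ _ _ _ _ _).
- by move=> g h.
- by move=> g h.
- move=> h X x0 Xx0 hX u.
  have [hv hu _] := hP h.
  apply: (valued_code_preserved hv Xx0) => x xX.
  have [y hy] := hX x xX; have yE := hbase _ _ _ hy.
  by have := hu (psi x); rewrite hy /= yE => <-.
- by move=> X g gX; rewrite /pr hatE.
- move=> X g x gX xX; rewrite /th hatE//= /psi.
  have xX' : valued_code typ x \in valued_code typ @: X by apply: imset_f.
  apply: etrans (clique_lift_section snd_permM (H := H) (A0 := A0) _ _ _ xX') _.
  + exact: shift_in.
  + exact: section.
  + by rewrite shift_imset.
  by rewrite /snd_perm /= shift_code.
- move=> X g k gX kX; have gkX := partial_autoM gX kX.
  apply: val_inj; apply: etrans (hatE _ _ gkX) _.
  apply: esym; apply: etrans (congr2 mulg (hatE _ _ gX) (hatE _ _ kX)) _.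
  rewrite /hat1; set a : vgT := (g, _); set b : vgT := (k, _).
  have abE : ((g * k)%g, shift sg typ X (g * k)%g) = (a * b)%g by rewrite shiftM.
  rewrite abE; congr pair; apply: esym; apply: etrans.
    apply: (clique_lift_comp snd_permM (H := H) (A0 := A0) (s' := base)).
    + exact: shift_in.
    + exact: shift_in.
    + exact: section.
    + by rewrite shift_imset.
    by rewrite -abE shift_imset.
  by rewrite shift_imset.
- by move=> h u w; have [_ _] := hP h.
- by move=> x y; apply: (base_section snd_permM H); apply: imset_f.
move=> C /(clique_translate snd_permM)[h hK1 hC].
exists (subg K h) => u /hC[_ /imsetP[x _ ->] hu].
by exists x; rewrite /th subgK.
Qed.

End CliqueCover.

Local Open Scope classical_set_scope.

(** * A finite quotient of a group with a finite orbit *)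
Section OrbitQuotient.
Variables (Gt : groupType) (Gam : groupClosed Gt) (Z : choiceType).
Variables (act : Gt -> Z -> Z) (z0 : Z).
Hypotheses (act1 : forall z, act 1%g z = z).
Hypothesis actM : forall g h z, act (g * h)%g z = act g (act h z).

(** The quotient is the group of permutations that [Gam] induces on the orbit.
    Permutations compose from left to right, whence the reversal of products. *)
Lemma finite_orbit_quotient :
  finite_set [set act g z0 | g in [set g | g \in Gam]] ->
  exists (K : finGroupType) (rho : Gt -> K),
  [/\ {in Gam &, forall g h, rho (g * h)%g = (rho h * rho g)%g},
      forall k, exists2 g, g \in Gam & rho g = k
    & {in Gam &, forall g h, rho g = rho h -> act g z0 = act h z0}].
Proof.
move=> /finite_seqP[s sE].
have sP z : reflect (exists2 g, g \in Gam & act g z0 = z) (z \in s).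
  apply: (iffP idP) => [zs|[g gG <-]].
    have : [set` s] z by exact: zs.
    by rewrite -sE => -[g gG <-]; exists g.
  have : [set` s] (act g z0) by rewrite -sE; exists g.
  by apply.
have actS g z : g \in Gam -> z \in s -> act g z \in s.
  by move=> gG /sP[h hG <-]; apply/sP; exists (g * h)%g; rewrite ?gpredM// actM.
pose moved g (x : seq_sub s) := insubd x (act g (ssval x)).
have movedE g x : g \in Gam -> ssval (moved g x) = act g (ssval x).
  by move=> gG; rewrite /moved [LHS]insubdK// actS// ssvalP.
have moved_inj g : g \in Gam -> injective (moved g).
  move=> gG x y /(congr1 (fun u => act g^-1%g (ssval u))).
  by rewrite !movedE// -!actM mulVg !act1 => /val_inj.
pose rho0 g := perm_of_fun (moved g).
have rho0E g x : g \in Gam -> ssval (rho0 g x) = act g (ssval x).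
  by move=> gG; rewrite /rho0 perm_of_funE ?movedE//; apply: moved_inj.
have rho0M g h : g \in Gam -> h \in Gam -> rho0 (g * h)%g = (rho0 h * rho0 g)%g.
  move=> gG hG; apply/permP => x; rewrite permM; apply: val_inj => /=.
  by rewrite !rho0E ?gpredM// actM.
pose K0 := [set k : {perm seq_sub s} | `[< exists2 g, g \in Gam & rho0 g = k >]]%SET.
have K0P k : reflect (exists2 g, g \in Gam & rho0 g = k) (k \in K0).
  by rewrite /K0 inE; apply: asboolP.
have K0group : group_set K0.
  apply/group_setP; split=> [|_ _ /K0P[g gG <-] /K0P[h hG <-]].
    apply/K0P; exists 1%g; rewrite ?gpred1//; apply/permP => x.
    by apply: val_inj => /=; rewrite rho0E ?gpred1// act1 perm1.
  by apply/K0P; exists (h * g)%g; rewrite ?gpredM// rho0M.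
pose K := Group K0group.
have rhoK g : g \in Gam -> rho0 g \in K by move=> gG; apply/K0P; exists g.
exists (subg_of K), (fun g => subg K (rho0 g)); split.
- move=> g h gG hG; apply: val_inj; transitivity (rho0 (g * h)%g).
    by apply: subgK; rewrite rhoK ?gpredM.
  by rewrite rho0M//; congr (_ * _)%g; symmetry; apply: subgK; apply: rhoK.
- move=> k; have /K0P[g gG gk] := subgP k; exists g => //.
  by rewrite gk sgvalK.
move=> g h gG hG /(congr1 (@sgval _ K)); rewrite !subgK ?rhoK// => E.
have zs : z0 \in s by apply/sP; exists 1%g; rewrite ?gpred1.
by rewrite -(rho0E g (SeqSub zs) gG) -(rho0E h (SeqSub zs) hG) E.
Qed.

End OrbitQuotient.

(** * Partial isomorphisms of a finite structure *)

(** Finite structures may be assumed to live on a [finType].  Taking the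
    countable type apart makes its structure agree by computation with that of
    the [finType] built on it. *)
Lemma finite_structure_finType (L : language) (P : structure L -> Prop) :
  (forall (T : finType) (S : structure_on L T), P (@Structure L T S)) ->
  forall A : structure L, finite_structure A -> P A.
Proof.
move=> PT [[V [m1 m2 m3]] S] /=; set W := Countable.Pack _.
move=> /finite_seqP[s sE].
have ax : @Finite.axiom W (undup s).
  move=> x; rewrite count_uniq_mem ?undup_uniq// mem_undup.
  suff -> : x \in s by [].
  suff : [set` s] x by [].
  by rewrite -sE.
pose T : finType := HB.pack (Countable.sort W) (isFinite.Build (Countable.sort W) ax).
exact: (PT T S).
Qed.

Section LangPermInverse.
Variable L : language.
Implicit Types g h : lang_perm L.

Lemma rel_permV g : rel_perm (g^-1)%g = rel_perm_inv g. Proof. by []. Qed.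
Lemma fun_permV g : fun_perm (g^-1)%g = fun_perm_inv g. Proof. by []. Qed.
Lemma relabel1 (V : Type) (S : structure_on L V) : relabel 1%g S = S.
Proof.
case: S => r f rs fs; rewrite /relabel /=.
by congr StructureOn; apply: Prop_irrelevance.
Qed.

Lemma relabelM (V : Type) g h (S : structure_on L V) :
  relabel (g * h)%g S = relabel g (relabel h S).
Proof.
case: S => r f rs fs; rewrite /relabel /=.
by congr StructureOn; apply: Prop_irrelevance.
Qed.

End LangPermInverse.

Section FiniteStructure.
Variables (L : language) (Gam : groupClosed (lang_perm L)).
Variables (T : finType) (S : structure_on L T).
Implicit Types (R : rel_sym L) (F : fun_sym L) (N X Y : {set T}).
Implicit Types (s t : {perm T}) (g h : lang_perm L).

(** For unary functions the vertex sets of substructures are those closed under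
    the functions on one-element sequences. *)
Definition closed_set N : bool :=
  `[< forall F x y, x \in N -> fun_int S F [:: x] y -> y \in N >].

Lemma closed_setP N :
  reflect (forall F x y, x \in N -> fun_int S F [:: x] y -> y \in N)
          (closed_set N).
Proof. exact: asboolP. Qed.

Definition local_iso X s g : Prop :=
  [/\ closed_set X, closed_set (s @: X),
      forall R l, {subset l <= X} ->
        (rel_int S R l <-> rel_int S (rel_perm g R) (map s l))
    & forall F x y, x \in X -> y \in X ->
        (fun_int S F [:: x] y <-> fun_int S (fun_perm g F) [:: s x] (s y))].

Lemma map_permKV s (l : seq T) : map s (map (s^-1)%g l) = l.
Proof. by rewrite -map_comp -[RHS]map_id; apply: eq_map => x /=; rewrite permKV. Qed.

Lemma imset_permK s X : (s^-1)%g @: (s @: X) = X.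
Proof.
by rewrite -imset_comp -[RHS]imset_id; apply: eq_imset => x /=; rewrite permK.
Qed.

Lemma imset_permP s X x : (x \in s @: X) = ((s^-1)%g x \in X).
Proof. by rewrite -{1}[x](permKV s) mem_imset//; apply: perm_inj. Qed.

Lemma local_iso1 X : closed_set X -> local_iso X 1%g 1%g.
Proof.
have E : (1%g : {perm T}) =1 id by move=> x; rewrite perm1.
move=> cX; split=> // [|R l _|F x y _ _]; last by rewrite !perm1.
  by rewrite (eq_imset _ E) imset_id.
by rewrite (eq_map E) map_id.
Qed.

Lemma local_isoV X s g : local_iso X s g -> local_iso (s @: X) (s^-1)%g (g^-1)%g.
Proof.
case=> cX csX rX fX; split=> //; first by rewrite imset_permK.
  move=> R l lX; rewrite [X in _ <-> X]rX; last first.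
    by move=> _ /mapP[x /lX + ->]; rewrite imset_permP.
  by rewrite map_permKV rel_permV rel_perm_invK.
move=> F x y; rewrite !imset_permP => xX yX.
by rewrite [X in _ <-> X]fX// !permKV fun_permV fun_perm_invK.
Qed.

Lemma local_isoM X s t g h : local_iso X s g -> local_iso (s @: X) t h ->
  local_iso X (s * t)%g (h * g)%g.
Proof.
case=> cX csX rX fX [_ ctX rsX fsX].
have E : (s * t)%g =1 t \o s by move=> x; rewrite permM.
split=> //; first by rewrite (eq_imset _ E) imset_comp.
  move=> R l lX; rewrite rX// rsX; last by move=> _ /mapP[x /lX xX ->]; rewrite imset_f.
  by rewrite (eq_map E) map_comp.
by move=> F x y xX yX; rewrite fX// fsX ?imset_f// !E.
Qed.

Lemma local_isoS X Y s g : local_iso X s g -> closed_set Y -> Y \subset X ->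
  local_iso Y s g.
Proof.
case=> _ /closed_setP csX rX fX cY YX; have YXP := fintype.subsetP YX.
split=> // [|R l lY|F x y xY yY]; last by apply: fX; apply: YXP.
  apply/closed_setP => F _ z /imsetP[x xY ->] xz.
  have /imsetP[y yX zE] := csX _ _ _ (imset_f s (YXP _ xY)) xz.
  move: xz; rewrite zE -[F](fun_perm_invK g) -fX ?(YXP x xY)// => xy.
  by apply: imset_f; move/closed_setP: cY => cY; apply: cY xY xy.
by apply: rX => x /lY /YXP.
Qed.

(** Being closed is reflected as well as preserved, since the inverse is a local
    isomorphism. *)
Lemma local_iso_closed X Y s g : local_iso X s g -> Y \subset X ->
  closed_set (s @: Y) -> closed_set Y.
Proof.
move=> /local_isoV sX YX csY.
by have [_ + _ _] := local_isoS sX csY (imsetS _ YX); rewrite imset_permK.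
Qed.

Definition closure_of (x : T) : {set T} :=
  [set y | [forall N : {set T}, (closed_set N && (x \in N)) ==> (y \in N)]]%SET.

Lemma closure_of_sub N x : closed_set N -> x \in N -> closure_of x \subset N.
Proof.
move=> cN xN; apply/fintype.subsetP => y; rewrite inE => /forallP/(_ N).
by rewrite cN xN.
Qed.

Lemma mem_closure_of x : x \in closure_of x.
Proof. by rewrite inE; apply/forallP => N; apply/implyP => /andP[]. Qed.

Lemma closure_of_closed x : closed_set (closure_of x).
Proof.
apply/closed_setP => F y z; rewrite !inE => /forallP yN yz; apply/forallP => N.
apply/implyP => cxN; have := yN N; rewrite cxN /= => yN'.
by have /andP[/closed_setP cN _] := cxN; apply: cN yN' yz.
Qed.

(** A local isomorphism and its inverse map closed sets to closed sets, hence
    closures to closures. *)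
Lemma local_iso_closure X s g x : local_iso X s g -> x \in X ->
  closure_of (s x) = s @: closure_of x.
Proof.
move=> sX xX; have [cX csX _ _] := sX.
apply/eqP; rewrite finset.eqEsubset; apply/andP; split.
  apply: closure_of_sub; last by rewrite imset_f// mem_closure_of.
  by case: (local_isoS sX (closure_of_closed x) (closure_of_sub cX xX)).
have cs : closure_of (s x) \subset s @: X by rewrite closure_of_sub// imset_f.
have [_ c' _ _] := local_isoS (local_isoV sX) (closure_of_closed (s x)) cs.
have : closure_of x \subset (s^-1)%g @: closure_of (s x).
  by rewrite closure_of_sub// imset_permP invgK mem_closure_of.
move/(imsetS s) => /fintype.subset_trans; apply; apply/fintype.subsetP => y.
by rewrite !imset_permP invgK permKV.
Qed.

Lemma closed_bigcup (l : seq T) : closed_set (\bigcup_(x <- l) closure_of x)%SET.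
Proof.
elim/big_rec: _ => [|x N _ /closed_setP cN].
  by apply/closed_setP => F x y; rewrite inE.
apply/closed_setP => F y z /finset.setUP[yx|yN] yz; apply/finset.setUP.
  by left; move/closed_setP: (closure_of_closed x) => /(_ F y z yx yz).
by right; apply: cN yz.
Qed.

Section Quotient.
Variables (Kq : finGroupType) (rho : lang_perm L -> Kq).
Hypothesis rhoM : {in Gam &, forall g h, rho (g * h)%g = (rho h * rho g)%g}.
Hypothesis rho_surj : forall k, exists2 g, g \in Gam & rho g = k.
Hypothesis rho_relabel :
  {in Gam &, forall g h, rho g = rho h -> relabel g S = relabel h S}.

Let gT : finGroupType := ({perm T} * Kq)%type.
Let sg (g : gT) : {perm T} := g.1.

Lemma rho1 : rho 1%g = 1%g.
Proof. by apply: (mulgI (rho 1%g)); rewrite -rhoM ?gpred1// !mulg1. Qed.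

Lemma rhoV g : g \in Gam -> rho (g^-1)%g = ((rho g)^-1)%g.
Proof.
by move=> gG; apply: (mulgI (rho g)); rewrite mulgV -rhoM ?gpredV// mulVg rho1.
Qed.

Lemma rho_int g h : g \in Gam -> h \in Gam -> rho g = rho h ->
  (forall R, rel_int S (rel_perm g R) = rel_int S (rel_perm h R)) /\
  (forall F, fun_int S (fun_perm g F) = fun_int S (fun_perm h F)).
Proof.
move=> gG hG gh; have E : relabel (g^-1)%g S = relabel (h^-1)%g S.
  by apply: rho_relabel; rewrite ?gpredV// !rhoV// gh.
split=> [R|F]; first by have := congr1 (fun S => rel_int S R) E.
by have := congr1 (fun S => fun_int S F) E.
Qed.

Lemma local_iso_lang X s g h : g \in Gam -> h \in Gam -> rho g = rho h ->
  local_iso X s g -> local_iso X s h.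
Proof.
move=> gG hG gh [cX csX rX fX]; have [rE fE] := rho_int gG hG gh.
by split=> // [R l lX|F x y xX yX]; rewrite -?rE -?fE; [apply: rX | apply: fX].
Qed.

(** This is false unless [X] is closed: an isomorphism between substructures has
    to be defined on the vertex set of one. *)
Definition local_type X (u : gT) : bool :=
  `[< exists2 g, g \in Gam & rho g = u.2 /\ local_iso X u.1 g >].

Lemma local_typeP X (u : gT) :
  reflect (exists2 g, g \in Gam & rho g = u.2 /\ local_iso X u.1 g)
          (local_type X u).
Proof. exact: asboolP. Qed.

(** Composing with the restriction of [s] to a closed subset [Y], or with its
    inverse, exchanges the isomorphisms defined on [Y] and on its image. *)
Lemma local_iso_partial_auto X s g : g \in Gam -> local_iso X s g ->
  partial_auto sg local_type X (s, rho g).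
Proof.
move=> gG sX Y YX u; apply/local_typeP/local_typeP => /= -[h hG [hu uY]].
  have cY : closed_set Y by case: uY => + _ _ _; apply: local_iso_closed sX YX.
  exists (h * g)%g; rewrite ?gpredM//= rhoM// hu; split=> //.
  by apply: local_isoM uY; apply: local_isoS sX cY YX.
have cY : closed_set Y by case: uY.
have sY := local_isoS sX cY YX.
exists (h * g^-1)%g; rewrite ?gpredM ?gpredV//.
rewrite rhoM ?gpredV// hu rhoV// mulKg; split=> //.
rewrite -(mulKg s u.1); apply: local_isoM; first exact: local_isoV.
by rewrite imset_permK.
Qed.

(** The identity belongs to the type of the closed set [X]; comparing types at
    [u^-1] shows that [u^-1], and therefore [u], is an isomorphism. *)
Lemma type_preserving_local_iso X (u : gT) : closed_set X ->
  type_preserving sg local_type X u ->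
  exists g, [/\ g \in Gam, rho g = u.2 & local_iso X u.1 g].
Proof.
move=> cX /(_ (u^-1)%g); rewrite mulgV.
have -> : local_type X 1%g.
  apply/local_typeP; exists 1%g; rewrite ?gpred1// rho1; split=> //.
  exact: local_iso1.
move=> /local_typeP[g gG [gu /local_isoV]]; rewrite imset_permK.
rewrite (_ : ((u^-1)%g.1^-1)%g = u.1); last exact: invgK.
move=> ug; exists (g^-1)%g; split=> //; first by rewrite gpredV.
by rewrite rhoV// gu; exact: invgK.
Qed.

End Quotient.

End FiniteStructure.

(** * Gluing copies of the structure along a clique cover *)
Section Gluing.
Variables (L : language) (Gam : groupClosed (lang_perm L)).
Hypothesis unaryL : forall F : fun_sym L, fun_arity F = 1%N.
Variables (T : finType) (S : structure_on L T).
Variables (Kq : finGroupType) (rho : lang_perm L -> Kq).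
Hypothesis rhoM : {in Gam &, forall g h, rho (g * h)%g = (rho h * rho g)%g}.
Hypothesis rho_surj : forall k, exists2 g, g \in Gam & rho g = k.
Hypothesis rho_relabel :
  {in Gam &, forall g h, rho g = rho h -> relabel g S = relabel h S}.

Let gT : finGroupType := ({perm T} * Kq)%type.
Let sg (g : gT) : {perm T} := g.1.
Let A : structure L := @Structure L T S.

Variable C : clique_cover sg (local_type Gam S rho).

Implicit Types (h k : cover_group C) (g : lang_perm L) (x y z : T).

Lemma cover_act1 : cover_act (1%g : cover_group C) = 1%g.
Proof. exact: action1 (@cover_actM _ _ _ _ C). Qed.

Lemma cover_proj1 : cover_proj (1%g : cover_group C) = 1%g.
Proof.
by apply: (mulgI (cover_proj (1%g : cover_group C))); rewrite -cover_projM !mulg1.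
Qed.

Lemma cover_projV h : cover_proj (h^-1)%g = ((cover_proj h)^-1)%g.
Proof. by apply: (mulgI (cover_proj h)); rewrite -cover_projM !mulgV cover_proj1. Qed.

Local Notation P := (cover_point C).

(** A vertex together with the copy of its closure.  An element of the cover
    group can fix the point of a vertex and move the points of its closure, so the
    point alone would not determine the values of the functions. *)
Definition rooted (x : T) : P * {set P} :=
  (cover_base C x, cover_base C @: closure_of S x)%SET.

Definition move_rooted h (u : P * {set P}) : P * {set P} :=
  (cover_act h u.1, cover_act h @: u.2)%SET.

Lemma move_rootedM h k u : move_rooted (h * k)%g u = move_rooted k (move_rooted h u).
Proof.
rewrite /move_rooted /= (imset_actM (@cover_actM _ _ _ _ C)).
by rewrite cover_actM permM.
Qed.

Definition rooted_orbit : {set P * {set P}} :=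
  [set move_rooted h (rooted x) | h : cover_group C, x : T]%SET.

Definition glued_vertex : finType := {u : P * {set P} | u \in rooted_orbit}.

Lemma rooted_in h x : move_rooted h (rooted x) \in rooted_orbit.
Proof. by apply/imset2P; exists h x. Qed.

Lemma move_in h (v : glued_vertex) : move_rooted h (val v) \in rooted_orbit.
Proof.
by case: v => _ /= /imset2P[k x _ _ ->]; rewrite -move_rootedM rooted_in.
Qed.

Definition glued_act h (v : glued_vertex) : glued_vertex := 
  exist (fun u => u \in rooted_orbit) _ (move_in h v).

Lemma glued_actM h k v : glued_act (h * k)%g v = glued_act k (glued_act h v).
Proof. by apply: val_inj; rewrite /= move_rootedM. Qed.

Lemma glued_act1 v : glued_act 1%g v = v.
Proof.
apply: val_inj; case: v => -[v N] /= _; rewrite /move_rooted cover_act1 /= perm1.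
by congr pair; rewrite -[RHS]imset_id; apply: eq_imset => u; rewrite perm1.
Qed.

Lemma glued_actK h : cancel (glued_act h) (glued_act h^-1%g).
Proof. by move=> v; rewrite -glued_actM mulgV glued_act1. Qed.

Lemma glued_actKV h : cancel (glued_act h^-1%g) (glued_act h).
Proof. by move=> v; rewrite -glued_actM mulVg glued_act1. Qed.

Lemma base_in x : rooted x \in rooted_orbit.
Proof.
have <- : move_rooted 1%g (rooted x) = rooted x; last exact: rooted_in.
rewrite /move_rooted cover_act1 /= perm1 /rooted; congr pair.
by rewrite -[RHS]imset_id; apply: eq_imset => u; rewrite perm1.
Qed.

Definition glued_base x : glued_vertex := 
  exist (fun u => u \in rooted_orbit) _ (base_in x).

Lemma glued_vertexP v : exists h x, v = glued_act h (glued_base x).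
Proof.
case: v => u uO; have /imset2P[h x _ _ uE] := uO; exists h, x.
exact: val_inj.
Qed.

Lemma glued_act_base_eq h x y : glued_act h (glued_base x) = glued_base y ->
  y = (cover_proj h).1 x /\
  forall z, z \in closure_of S x ->
    exists z', cover_act h (cover_base C z) = cover_base C z'.
Proof.
move=> /(congr1 val) [/cover_act_base yE E]; split=> // z zx.
have : cover_act h (cover_base C z) \in
    (cover_act h @: (cover_base C @: closure_of S x))%SET.
  by rewrite !imset_f.
by rewrite E => /imsetP[z' _ ->]; exists z'.
Qed.

Lemma glued_base_inj : injective glued_base.
Proof.
move=> x y E; have := @glued_act_base_eq 1%g x y; rewrite glued_act1 E.
by case=> // -> _; rewrite cover_proj1 perm1.
Qed.

(** The language parts that may accompany the action of [h]. *)
Definition matches g h := g \in Gam /\ rho g = (cover_proj h).2.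

Lemma matches1 : matches 1%g 1%g.
Proof. by split; [exact: gpred1 | rewrite cover_proj1 (rho1 rhoM)]. Qed.

Lemma matchesM g1 g2 h k : matches g1 h -> matches g2 k ->
  matches (g2 * g1)%g (h * k)%g.
Proof.
by move=> [g1G g1h] [g2G g2k]; split; rewrite ?gpredM// rhoM// g1h g2k cover_projM.
Qed.

Lemma matchesV g h : matches g h -> matches (g^-1)%g (h^-1)%g.
Proof.
move=> [gG gh]; split; first by rewrite gpredV.
by rewrite (rhoV rhoM gG) gh cover_projV.
Qed.

Lemma matches_surj h : exists g, matches g h.
Proof. by have [g gG gh] := rho_surj (cover_proj h).2; exists g. Qed.

Lemma glued_act_base h g (X : {set T}) :
  local_iso S X (cover_proj h).1 g ->
  (forall z, z \in X ->
     cover_act h (cover_base C z) = cover_base C ((cover_proj h).1 z)) ->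
  forall x, x \in X ->
    glued_act h (glued_base x) = glued_base ((cover_proj h).1 x).
Proof.
move=> Xg hX x xX; apply: val_inj => /=; rewrite /move_rooted /rooted /=.
rewrite hX// (local_iso_closure Xg xX) -!imset_comp; congr pair.
apply: eq_in_imset => z zx /=; apply: hX; have [cX _ _ _] := Xg.
by apply: (fintype.subsetP (closure_of_sub cX xX)).
Qed.

(** Overlaps of translates of the copy of [A] come from local isomorphisms.  This
    makes relations and functions on the glued structure well defined. *)
Lemma local_iso_of_cover h (X : {set T}) x0 : closed_set S X -> x0 \in X ->
  (forall z, z \in X -> exists z', cover_act h (cover_base C z) = cover_base C z') ->
  exists g, [/\ matches g h, local_iso S X (cover_proj h).1 g
    & forall x, x \in X ->
        glued_act h (glued_base x) = glued_base ((cover_proj h).1 x)].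
Proof.
move=> cX x0X hX; have tX := cover_type_preserving x0X hX.
have [g [gG gh Xg]] := type_preserving_local_iso rhoM cX tX.
exists g; split=> //; apply: (glued_act_base Xg) => z /hX[z' zE].
by rewrite zE (cover_act_base zE).
Qed.

Lemma local_iso_of_base h (l : seq T) : l != [::] ->
  (forall x, x \in l -> exists y, glued_act h (glued_base x) = glued_base y) ->
  exists (X : {set T}) g, [/\ matches g h, {subset l <= X},
    local_iso S X (cover_proj h).1 g
    & forall x, x \in X ->
        glued_act h (glued_base x) = glued_base ((cover_proj h).1 x)].
Proof.
move=> l0 lP; pose X := (\bigcup_(x <- l) closure_of S x)%SET.
have lX : {subset l <= X}.
  move=> x xl; rewrite /X (big_rem x xl) /=; apply/finset.setUP; left.
  exact: mem_closure_of.
have [x0 x0l] : exists x0, x0 \in l.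
  by case: (l) l0 => // x0 m _; exists x0; apply: mem_head.
have [] := @local_iso_of_cover h X x0; [exact: closed_bigcup | exact: lX | |].
  move=> z; have : forall m, {subset m <= l} ->
      z \in (\bigcup_(x <- m) closure_of S x)%SET ->
      exists2 x, x \in l & z \in closure_of S x.
    elim=> [_|x m IH ml]; first by rewrite big_nil inE.
    rewrite big_cons => /finset.setUP[zx|].
      by exists x; rewrite // ml ?mem_head.
    by apply: IH => y ym; apply: ml; rewrite in_cons ym orbT.
  move=> /(_ l) + zX => -[]// x xl zx.
  by have [y /glued_act_base_eq[_]] := lP x xl; apply.
by move=> g [gh Xg hX]; exists X, g.
Qed.

(** Relations and functions are the translates of those of [A], relabelled by the
    language part of the translation. *)
Program Definition glued_interp : structure_on L glued_vertex :=
  @StructureOn L glued_vertex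
    (fun R => [set l | exists h g m, [/\ matches g h,
       l = map (glued_act h \o glued_base) m & rel_int S (rel_perm_inv g R) m]])
    (fun F l => [set v | exists h g x y, [/\ matches g h,
       l = [:: glued_act h (glued_base x)], v = glued_act h (glued_base y)
       & fun_int S (fun_perm_inv g F) [:: x] y]]) _ _.
Next Obligation.
move=> R _ [h [g [m [_ -> /rel_int_size mR]]]].
by rewrite size_map mR rel_perm_inv_arity.
Qed.
Next Obligation.
move=> F l lF; apply/seteqP; split=> // v [h [g [x [y [_ lE _ _]]]]].
by case: lF; rewrite lE unaryL.
Qed.

Definition glued : structure L := @Structure L glued_vertex glued_interp.

Definition glued_map h g : gmap glued glued := @GMap L glued glued g (glued_act h).

Lemma rel_int_glued_act h g R (l : seq glued) : matches g h ->
  rel_int glued R l -> rel_int glued (rel_perm g R) (map (glued_act h) l).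
Proof.
move=> gh [k [g' [m [g'k -> Rm]]]]; exists (k * h)%g, (g * g')%g, m.
split; first exact: matchesM.
  by rewrite -map_comp; apply: eq_map => x /=; rewrite glued_actM.
by rewrite /= rel_permK.
Qed.

Lemma fun_int_glued_act h g F (l : seq glued) (v : glued) : matches g h ->
  fun_int glued F l v ->
  fun_int glued (fun_perm g F) (map (glued_act h) l) (glued_act h v).
Proof.
move=> gh [k [g' [x [y [g'k -> -> Fxy]]]]]; exists (k * h)%g, (g * g')%g, x, y.
by rewrite !glued_actM /= fun_permK; split=> //; exact: matchesM.
Qed.

Lemma map_glued_actK h (l : seq glued) :
  map (glued_act h^-1%g) (map (glued_act h) l) = l.
Proof. by rewrite -map_comp -[RHS]map_id; apply: eq_map => v; apply: glued_actK. Qed.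

Lemma glued_map_auto h g : matches g h -> is_automorphism Gam (glued_map h g).
Proof.
move=> gh; have [gG _] := gh; split; last first.
  by exists (glued_act h^-1%g); [exact: glued_actK | exact: glued_actKV].
split=> //=; first exact: can_inj (glued_actK h).
  move=> R l; split; first exact: rel_int_glued_act.
  by move/(rel_int_glued_act (matchesV gh)); rewrite map_glued_actK rel_permV rel_permK.
move=> F l; apply/seteqP; split=> [_ [v Fv <-]|v].
  exact: fun_int_glued_act.
move/(fun_int_glued_act (matchesV gh)); rewrite map_glued_actK fun_permV fun_permK.
by move=> Fv; exists (glued_act h^-1%g v) => //; apply: glued_actKV.
Qed.

Definition base_map : gmap A glued := @GMap L A glued 1%g glued_base.

(** No new relation or function value is created within [A]: one that comes from
    another translate is transported to [A] by a local isomorphism. *)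
Lemma base_map_embedding : is_embedding Gam base_map.
Proof.
split=> /=; [exact: gpred1 | exact: glued_base_inj | |].
- move=> R l; split=> [Rl|[h [g [m [gh lm Rm]]]]].
    exists 1%g, 1%g, l; split=> //; first exact: matches1.
    by apply: eq_map => x /=; rewrite glued_act1.
  have m0 : m != [::].
    apply: contraTneq (rel_arity_gt0 (rel_perm_inv g R)) => m0.
    by rewrite -(rel_int_size Rm) m0.
  have mP x : x \in m -> exists y, glued_act h (glued_base x) = glued_base y.
    move=> xm; have : glued_act h (glued_base x) \in map glued_base l.
      by rewrite lm; apply: (map_f (glued_act h \o glued_base)).
    by move=> /mapP[y _ ->]; exists y.
  have [X [g' [g'h mX Xg hX]]] := local_iso_of_base m0 mP.
  have lE : l = map (cover_proj h).1 m.
    apply: (inj_map glued_base_inj); rewrite lm -map_comp.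
    by apply/eq_in_map => x /mX xX /=; apply: hX.
  have {}Xg : local_iso S X (cover_proj h).1 g.
    have [gG ghE] := gh; have [g'G g'hE] := g'h.
    by apply: (local_iso_lang rhoM rho_relabel g'G gG _ Xg); rewrite ghE.
  have [_ _ rX _] := Xg.
  by have := (rX _ _ mX).1 Rm; rewrite rel_perm_invK -lE.
move=> F l; apply/seteqP; split=> [_ [y Fy <-]|v [h [g [x [y [gh lx -> Fxy]]]]]].
  have [x lE] : exists x, l = [:: x].
    have : size l = 1.
      by apply: contrapT => l1; move: Fy; rewrite fun_int_size// unaryL.
    by case: l {Fy} => [|x []]// _; exists x.
  exists 1%g, 1%g, x, y; rewrite !glued_act1 lE; split=> //; first exact: matches1.
  by rewrite -lE.
have [x' lE hx] : exists2 x', l = [:: x'] & glued_act h (glued_base x) = glued_base x'.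
  case: l lx => [|x' []]// /(congr1 (head (glued_base x'))) /= E.
  by exists x'.
have [] := @local_iso_of_base h [:: x] isT.
  by move=> z; rewrite inE => /eqP ->; exists x'.
move=> X [g' [g'h xX Xg hX]]; have {}xX := xX x (mem_head _ _).
have {}Xg : local_iso S X (cover_proj h).1 g.
  have [gG ghE] := gh; have [g'G g'hE] := g'h.
  by apply: (local_iso_lang rhoM rho_relabel g'G gG _ Xg); rewrite ghE.
case: Xg => /closed_setP cX _ _ fX; have yX := cX _ _ _ xX Fxy.
exists ((cover_proj h).1 y); last by rewrite -hX.
have -> : l = [:: (cover_proj h).1 x].
  by rewrite lE; congr [:: _]; apply: glued_base_inj; rewrite -hx hX.
by move: Fxy; rewrite fX// fun_perm_invK.
Qed.

End Gluing.

(** * Irreducible structures with unary functions *)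
Section FreeAmalgamation.
Variables (L : language) (Gam : groupClosed (lang_perm L)).
Hypothesis unaryL : forall F : fun_sym L, fun_arity F = 1%N.
Variable B : structure L.

Lemma fun_int_unary F (l : seq B) v : fun_int B F l v -> exists x, l = [:: x].
Proof.
move=> Flv; have : size l = 1.
  by apply: contrapT => l1; move: Flv; rewrite fun_int_size// unaryL.
by case: l {Flv} => [|x []]// _; exists x.
Qed.

Lemma incl_sub_embedding (D E : substructure B) (DE : vset D `<=` vset E) :
  is_embedding Gam (incl_sub DE).
Proof.
have val_incl (l : seq (vset D)) : map val (map (incl_sub DE) l) = map val l.
  by rewrite -map_comp; apply: eq_map => x.
split=> /=; first exact: gpred1.
- by move=> x y /(congr1 val) /= /val_inj.
- by move=> R l; rewrite val_incl.
move=> F l; apply/seteqP; split=> [_ [x Fx <-]|y] /=; rewrite val_incl//.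
move=> Fy; have yD := vset_closed (@map_val_sub _ _ D l) Fy.
by exists (SigSub (mem_set yD)) => //; apply: val_inj.
Qed.

(** The largest substructure without [u].  It exists because, for unary
    functions, unions of substructures are substructures. *)
Program Definition avoiding (u : B) : substructure B :=
  @Substructure L B [set z | exists2 N : substructure B, vset N z & ~ vset N u] _.
Next Obligation.
move=> u F l lu v Flv; have [z lz] := fun_int_unary Flv.
have /set_mem[N Nz Nu] :
    z \in [set z | exists2 N : substructure B, vset N z & ~ vset N u].
  by apply: lu; rewrite lz mem_head.
exists N => //; apply: (vset_closed _ Flv) => _ /[!lz] /[!inE] /eqP ->.
exact: Nz.
Qed.

Program Definition meet_sub (D E : substructure B) : substructure B :=
  @Substructure L B (vset D `&` vset E) _.
Next Obligation.
move=> D E F l lDE v Flv; split; apply: (vset_closed _ Flv) => x /lDE /set_mem[].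
  by move=> xD _; apply: mem_set.
by move=> _; apply: mem_set.
Qed.

(** If every vertex lies in a substructure missing [u] or [w], then [B] is the
    union of [avoiding u] and [avoiding w], both proper.  Irreducibility provides a
    tuple in a relation that prevents this amalgamation from being free; such a
    tuple is contained neither in [avoiding u] nor in [avoiding w], so a
    substructure that contains it contains both [u] and [w]. *)
Lemma irreducible_pair (u w : B) : irreducible Gam B ->
  (forall v, exists2 N : substructure B, vset N v & ~ (vset N u /\ vset N w)) ->
  exists l : seq B, (exists R, rel_int B R l) /\
    forall N : substructure B, {subset l <= vset N} -> vset N u /\ vset N w.
Proof.
move=> Birr Bcov; apply: contrapT => nR; apply: Birr.
pose D1 := avoiding u; pose D2 := avoiding w; pose D0 := meet_sub D1 D2.
have D01 : vset D0 `<=` vset D1 by move=> x [].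
have D02 : vset D0 `<=` vset D2 by move=> x [].
have sub12 (N : substructure B) : ~ (vset N u /\ vset N w) ->
    vset N `<=` vset D1 \/ vset N `<=` vset D2.
  move=> nN; have [Nu|Nu] := EM (vset N u).
    by right=> x Nx; exists N => // Nw; apply: nN.
  by left=> x Nx; exists N.
exists D1, D2, D0, D01, D02; split.
- by move=> D1T; have [N] : vset D1 u by rewrite D1T.
- by move=> D2T; have [N] : vset D2 w by rewrite D2T.
have range_incl (D : substructure B) : range (Defs.incl D) = vset D.
  apply/seteqP; split=> [_ [x _ <-]|x xD]; first exact: set_valP.
  by exists (SigSub (mem_set xD)).
split.
- split.
    split; [by split; exact: incl_sub_embedding|by split; exact: incl_embedding|].
    by congr GMap.
  by rewrite !range_incl.
- apply/seteqP; split=> // v _; rewrite !range_incl.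
  have [N Nv nN] := Bcov v.
  by case: (sub12 N nN) => sN; [left | right]; apply: sN.
have out1 (x : B) : (Defs.incl D1 @` (~` range (incl_sub D01))) x -> ~ vset D2 x.
  move=> [z zD <-] zD2; apply: zD.
  have zD0 : vset D0 (val z) by split=> //; exact: set_valP.
  by exists (SigSub (mem_set zD0)) => //; apply: val_inj.
have out2 (x : B) : (Defs.incl D2 @` (~` range (incl_sub D02))) x -> ~ vset D1 x.
  move=> [z zD <-] zD1; apply: zD.
  have zD0 : vset D0 (val z) by split=> //; exact: set_valP.
  by exists (SigSub (mem_set zD0)) => //; apply: val_inj.
move=> l [x xl x1] [y yl y2]; split=> [R Rl|F].
  apply: nR; exists l; split; first by exists R.
  move=> N lN; apply: contrapT => /sub12[] sN.
    by apply: (out2 y) => //; apply: sN; apply/set_mem/lN.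
  by apply: (out1 x) => //; apply: sN; apply/set_mem/lN.
apply/seteqP; split=> // v Flv; have [z lz] := fun_int_unary Flv.
move: xl yl; rewrite lz !inE => /eqP xz /eqP yz.
case: x1 => x' _ x'E; apply: (out2 y) => //; rewrite yz -xz -x'E.
exact: set_valP.
Qed.

End FreeAmalgamation.

(** * Partial automorphisms of the image as maps between vertices *)
Section Trace.
Variables (L : language) (Gam : groupClosed (lang_perm L)).
Variables (T : finType) (S : structure_on L T).
Let A : structure L := @Structure L T S.
Variables (B : structure L) (psi : embedding Gam A B).
Hypothesis psi1 : lang_part psi = 1%g.
Local Notation P := (Defs.image_sub psi).

Let psi_inj : injective psi. Proof. by case: (embP psi). Qed.

Let psiR R l : rel_int S R l <-> rel_int B R (map psi l).
Proof. by case: (embP psi) => _ _ /(_ R l); rewrite psi1. Qed.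

Let psiF F x y : fun_int S F [:: x] y <-> fun_int B F [:: psi x] (psi y).
Proof.
case: (embP psi) => _ _ _ /(_ F [:: x]); rewrite psi1 /= => <-.
by split=> [Fy|[z Fz /psi_inj <-]//]; exists y.
Qed.

Definition image_pt (x : A) : P := SigSub (mem_set (imageT psi x)).

Definition trace_dom (D : substructure P) : {set T} :=
  [set x : T | image_pt x \in vset D]%SET.

Lemma trace_domP (D : substructure P) (x : T) : x \in trace_dom D ->
  exists d : vset D, val (val d) = psi x.
Proof. by rewrite inE => xD; exists (SigSub xD). Qed.

Lemma trace_domE (D : substructure P) (d : vset D) :
  exists2 x : T, x \in trace_dom D & val (val d) = psi x.
Proof.
have [x _ xd] := set_valP (val d); exists x => //; rewrite inE.
have -> : image_pt x = val d by apply: val_inj.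
exact: valP.
Qed.

Lemma trace_dom_closed (D : substructure P) : closed_set S (trace_dom D).
Proof.
apply/closed_setP => F x y; rewrite !inE => xD Fxy.
apply: (vset_closed (s := [:: image_pt x])); last exact: (psiF F x y).1 Fxy.
by move=> z; rewrite inE => /eqP ->; exact: mem_set.
Qed.

Variables (D E : substructure P) (f : gmap D E).

(** The partial map that [f] induces on the vertices of [A].  Values outside the
    domain are arbitrary. *)
Definition trace (x : T) : T :=
  odflt x [pick y | `[< exists2 d : vset D, val (val d) = psi x &
                                            val (val (f d)) = psi y >]].

Lemma traceE (d : vset D) x : val (val d) = psi x ->
  val (val (f d)) = psi (trace x).
Proof.
move=> dx; rewrite /trace; case: pickP => [y /asboolP[d' d'x d'y]|].
  suff -> : d = d' by [].
  by do 2!apply: val_inj; rewrite dx d'x.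
have [y _ yE] := trace_domE (f d).
by move=> /(_ y)/asboolP[]; exists d.
Qed.

Hypothesis f_iso : is_isomorphism Gam f.

Lemma trace_inj : {in trace_dom D &, injective trace}.
Proof.
have [[_ f_inj _ _] _] := f_iso.
move=> x y /trace_domP[d dx] /trace_domP[e ey] xy.
suff de : d = e by apply: psi_inj; rewrite -dx -ey de.
by apply: f_inj; do 2!apply: val_inj; rewrite (traceE dx) (traceE ey) xy.
Qed.

Lemma trace_imset : (trace @: trace_dom D)%SET = trace_dom E.
Proof.
have [_ [f' fK f'K]] := f_iso.
apply/setP => y; apply/imsetP/idP => [[x /trace_domP[d dx] ->]|].
  have [y' y'E yE] := trace_domE (f d).
  by rewrite (_ : trace x = y')//; apply: psi_inj; rewrite -yE (traceE dx).
move=> /trace_domP[e ey]; have [x xD dx] := trace_domE (f' e).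
by exists x => //; apply: psi_inj; rewrite -ey -(traceE dx) f'K.
Qed.

Lemma trace_seq (l : seq T) : {subset l <= trace_dom D} ->
  exists2 m : seq D, map val (map val m) = map psi l &
    map val (map val (map f m)) = map psi (map trace l).
Proof.
elim: l => [|x l IH] lD; first by exists [::].
have [d dx] := trace_domP (lD x (mem_head _ _)).
have [|m mE fmE] := IH; first by move=> y yl; apply: lD; rewrite in_cons yl orbT.
by exists (d :: m) => /=; rewrite ?dx ?mE// (traceE dx) fmE.
Qed.

Definition trace_perm : {perm T} := perm_of_fun (ext (trace_dom D) trace).

Lemma trace_permE : trace_perm =1 ext (trace_dom D) trace.
Proof. by apply: perm_of_funE; apply: ext_inj; apply: trace_inj. Qed.

Lemma trace_perm_in x : x \in trace_dom D -> trace_perm x = trace x.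
Proof. by move=> xD; rewrite trace_permE extE. Qed.

Lemma trace_perm_imset : (trace_perm @: trace_dom D)%SET = trace_dom E.
Proof. by rewrite -trace_imset; apply: eq_in_imset => x; apply: trace_perm_in. Qed.

Lemma trace_local_iso : local_iso S (trace_dom D) trace_perm (lang_part f).
Proof.
have [[_ f_inj fR fF] _] := f_iso.
split; [exact: trace_dom_closed | | |].
  by rewrite trace_perm_imset; exact: trace_dom_closed.
  move=> R l lD; have [m mE fmE] := trace_seq lD.
  have -> : map trace_perm l = map trace l.
    by apply/eq_in_map => x /lD; apply: trace_perm_in.
  by rewrite !psiR -mE -fmE; apply: fR.
move=> F x y xD yD; have [dx dxE] := trace_domP xD; have [dy dyE] := trace_domP yD.
rewrite !trace_perm_in// !psiF -(traceE dxE) -(traceE dyE) -dxE -dyE.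
have FE := fF F [:: dx]; split=> [Fd|].
  suff: fun_int E (fun_perm (lang_part f) F) (map f [:: dx]) (f dy) by [].
  by rewrite -FE; exists dy.
move=> Fd.
have : fun_int E (fun_perm (lang_part f) F) (map f [:: dx]) (f dy) by exact: Fd.
by rewrite -FE => -[z Fz /f_inj <-].
Qed.

End Trace.

Lemma trace_gcomp (L : language) (Gam : groupClosed (lang_perm L)) (T : finType)
    (S : structure_on L T) (B : structure L)
    (psi : embedding Gam (@Structure L T S) B)
    (D E H : substructure (Defs.image_sub psi)) (f : gmap D E) (g : gmap E H) :
  {in trace_dom D, trace (gcomp g f) =1 trace g \o trace f}.
Proof.
move=> x /trace_domP[d dx] /=; have [_ psi_inj _ _] := embP psi.
apply: psi_inj; rewrite -(traceE (gcomp g f) dx) /=.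
by rewrite -(traceE g (traceE f dx)).
Qed.

Lemma trace_perm_gcomp (L : language) (Gam : groupClosed (lang_perm L))
    (T : finType) (S : structure_on L T) (B : structure L)
    (psi : embedding Gam (@Structure L T S) B)
    (D E H : substructure (Defs.image_sub psi)) (f : gmap D E) (g : gmap E H) :
  is_isomorphism Gam f -> is_isomorphism Gam g ->
  is_isomorphism Gam (gcomp g f) ->
  trace_perm (gcomp g f) = (trace_perm f * trace_perm g)%g.
Proof.
move=> f_iso g_iso gf_iso; apply/permP => x.
rewrite permM !trace_permE// -(trace_imset f_iso) ext_comp.
- by apply: eq_in_ext; apply: trace_gcomp.
- exact: trace_inj.
by rewrite trace_imset//; apply: trace_inj.
Qed.

(** * The glued structure is a witness *)
Lemma gcomp_isomorphism (L : language) (Gam : groupClosed (lang_perm L))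
    (A B D : structure L) (f : gmap A B) (g : gmap B D) :
  is_isomorphism Gam f -> is_isomorphism Gam g -> is_isomorphism Gam (gcomp g f).
Proof.
move=> [[fG fI fR fF] f_bij] [[gG gI gR gF] g_bij]; split; last exact: bij_comp.
split=> /=; [exact: gpredM | exact: inj_comp | |].
  by move=> R l; rewrite fR gR -map_comp.
by move=> F l; rewrite -image_comp fF gF -map_comp.
Qed.

Section Witness.
Variables (L : language) (Gam : groupClosed (lang_perm L)).
Hypothesis unaryL : forall F : fun_sym L, fun_arity F = 1%N.
Variables (T : finType) (S : structure_on L T).
Variables (Kq : finGroupType) (rho : lang_perm L -> Kq).
Hypothesis rhoM : {in Gam &, forall g h, rho (g * h)%g = (rho h * rho g)%g}.
Hypothesis rho_surj : forall k, exists2 g, g \in Gam & rho g = k.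
Hypothesis rho_relabel :
  {in Gam &, forall g h, rho g = rho h -> relabel g S = relabel h S}.
Variable C : clique_cover (fun g : {perm T} * Kq => g.1) (local_type Gam S rho).

Let A : structure L := @Structure L T S.
Let B : structure L := glued unaryL C.
Let psi : embedding Gam A B :=
  Embedding (base_map_embedding unaryL rhoM rho_relabel C).

(** The vertex part extends [f] along the cover, after completing [f] to a
    permutation of the vertices of [A]; both completions are coherent. *)
Definition hat_map (D E : substructure (Defs.image_sub psi)) (f : gmap D E) :
    gmap B B :=
  glued_map unaryL
    (cover_ext C (trace_dom D) (trace_perm f, rho (lang_part f))) (lang_part f).

Section Hat.
Variables (D E : substructure (Defs.image_sub psi)) (f : gmap D E).
Hypothesis f_iso : is_isomorphism Gam f.

Lemma hat_partial_auto :
  partial_auto (fun g : {perm T} * Kq => g.1) (local_type Gam S rho)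
    (trace_dom D) (trace_perm f, rho (lang_part f)).
Proof.
have [[fG _ _ _] _] := f_iso.
by apply: (local_iso_partial_auto rhoM fG); apply: trace_local_iso.
Qed.

Lemma hat_automorphism : is_automorphism Gam (hat_map f).
Proof.
have [[fG _ _ _] _] := f_iso.
apply: glued_map_auto => //; split=> //.
by rewrite (cover_proj_ext C hat_partial_auto).
Qed.

Lemma hat_extends : extends f (hat_map f).
Proof.
split=> // d; have [x xD dx] := trace_domE d.
rewrite (traceE f dx) dx -(trace_perm_in f_iso xD) /=.
have pE := cover_proj_ext C hat_partial_auto.
have := @glued_act_base _ _ _ _ _ _ C
  (cover_ext C (trace_dom D) (trace_perm f, rho (lang_part f))) (lang_part f)
  (trace_dom D).
rewrite pE => /(_ (trace_local_iso _ f_iso)) ->//.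
by move=> z zD; rewrite (cover_ext_base C hat_partial_auto zD).
Qed.

End Hat.

Lemma hat_gcomp (D E H : substructure (Defs.image_sub psi)) (f : gmap D E)
    (g : gmap E H) : is_isomorphism Gam f -> is_isomorphism Gam g ->
  hat_map (gcomp g f) = gcomp (hat_map g) (hat_map f).
Proof.
move=> f_iso g_iso; have gf_iso := gcomp_isomorphism f_iso g_iso.
have [[fG _ _ _] _] := f_iso; have [[gG _ _ _] _] := g_iso.
have extE : cover_ext C (trace_dom D)
      (trace_perm (gcomp g f), rho (lang_part (gcomp g f))) =
    (cover_ext C (trace_dom D) (trace_perm f, rho (lang_part f)) *
     cover_ext C (trace_dom E) (trace_perm g, rho (lang_part g)))%g.
  have -> : (trace_perm (gcomp g f), rho (lang_part (gcomp g f))) =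
      ((trace_perm f, rho (lang_part f)) * (trace_perm g, rho (lang_part g)))%g.
    by rewrite (trace_perm_gcomp f_iso g_iso gf_iso) (rhoM gG fG).
  have pg := hat_partial_auto g_iso; rewrite -(trace_perm_imset f_iso) in pg *.
  exact: (cover_extM C (hat_partial_auto f_iso) pg).
rewrite /hat_map extE; congr GMap; apply/funext => v; exact: glued_actM.
Qed.

Lemma glued_coherent : coherent_EPPA_for psi.
Proof.
exists hat_map; split=> [D E f f_iso|D E H f g]; last exact: hat_gcomp.
by split; [exact: hat_automorphism | exact: hat_extends].
Qed.

Lemma coherent_EPPA : coherent_EPPA_for psi -> EPPA_for psi.
Proof.
move=> [hat [hatP _]] D E f /hatP[h1 h2].
by exists (hat D E f).
Qed.

(** By automorphisms it suffices to consider the copy of [A] itself, which is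
    closed as the image of an embedding. *)
Lemma translate_closed h F (u v : B) x : u = glued_act h (glued_base C x) ->
  fun_int B F [:: u] v -> exists y, v = glued_act h (glued_base C y).
Proof.
move=> -> Fv; have [g gh] := matches_surj rho_surj h.
have [_ _ _ embF] := base_map_embedding unaryL rhoM rho_relabel C.
have imF : base_map unaryL C @` fun_int S (fun_perm (g^-1)%g F) [:: x] =
    fun_int B (fun_perm (g^-1)%g F) [:: glued_base C x] by exact: embF.
have : fun_int B (fun_perm (g^-1)%g F) [:: glued_base C x] (glued_act h^-1%g v).
  rewrite -[glued_base C x](glued_actK h).
  exact: (fun_int_glued_act rhoM (matchesV rhoM gh) Fv).
rewrite -imF => -[y _ /= yE].
by exists y; rewrite yE glued_actKV.
Qed.

Program Definition translate_sub (D : substructure B) (h : cover_group C) :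
    substructure D :=
  @Substructure L D [set d | exists x, val d = glued_act h (glued_base C x)] _.
Next Obligation.
move=> D h F l lh d Fd; have [c lc] := fun_int_unary unaryL Fd.
have /set_mem[x cx] :
    c \in [set d : vset D | exists x, val d = glued_act h (glued_base C x)].
  by apply: lh; rewrite lc mem_head.
apply: (@translate_closed h F (val c) (val d) x cx).
by move: Fd; rewrite lc.
Qed.

(** A tuple in a relation lies by definition in one translate of [A], and
    translates of [A] are substructures. *)
Lemma irreducible_translate (D : substructure B) : irreducible Gam D ->
  forall u w : vset D, exists h x y, val u = glued_act h (glued_base C x) /\
    val w = glued_act h (glued_base C y).
Proof.
move=> Dirr u w; apply: contrapT => nuw.
have nh h : ~ (vset (translate_sub D h) u /\ vset (translate_sub D h) w).
  by move=> [[x ux] [y wy]]; apply: nuw; exists h, x, y.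
have [|l [[R [h [g [m [_ lE _]]]]] lN]] := @irreducible_pair L Gam unaryL D u w Dirr.
  move=> v; have [h [x vE]] := glued_vertexP (val v).
  by exists (translate_sub D h) => //; exists x.
apply: (nh h); apply: lN => d dl; apply: mem_set.
have : val d \in map val l by apply: map_f.
by rewrite lE => /mapP[x _ dE]; exists x.
Qed.

(** The points of all closures attached to vertices of the irreducible
    substructure form a clique.  Once they are moved into the copy of [A], each
    attached closure becomes the closure of a vertex of [A]. *)
Lemma glued_faithful : irreducible_structure_faithful_for psi.
Proof.
move=> D Dirr; have pairs := irreducible_translate Dirr.
pose U : {set cover_point C} :=
  [set a | `[< exists2 v : B, vset D v & a \in (val v).2 >]]%SET.
have UP a : reflect (exists2 v : B, vset D v & a \in (val v).2) (a \in U).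
  by rewrite /U finset.in_set; exact: asboolP.
have [|h hU] := @cover_clique _ _ _ _ C U.
  move=> a b /UP[v vD av] /UP[w wD bw].
  have [k [x [y [/= vE wE]]]] := pairs (SigSub (mem_set vD)) (SigSub (mem_set wD)).
  move: av bw; rewrite vE wE /= => /imsetP[_ /imsetP[a' _ ->] ->].
  move=> /imsetP[_ /imsetP[b' _ ->] ->].
  by rewrite cover_edge_act cover_edge_base.
have [g gh] := matches_surj rho_surj h.
exists (glued_map unaryL h g); first exact: glued_map_auto.
move=> _ [v vD <-]; have [k [x vE]] := glued_vertexP v.
have [] := @local_iso_of_cover _ _ _ _ _ _ rhoM C (k * h)%g (closure_of S x) x.
- exact: closure_of_closed.
- exact: mem_closure_of.
- move=> z zx; rewrite cover_actM permM; apply: hU; apply/UP; exists v => //.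
  by rewrite vE /= !imset_f.
move=> _ [_ _ /(_ x (mem_closure_of S x)) E].
by exists ((cover_proj (k * h)%g).1 x); rewrite //= -E glued_actM -vE.
Qed.

End Witness.

Theorem theorem1p1 (L : language) (Gam : groupClosed (lang_perm L))
    (unaryL : forall F : fun_sym L, fun_arity F = 1%N) :
  (forall A : structure L,
     finite_structure A -> finite_set (relabel_orbit Gam A) ->
     exists2 B : structure L,
       finite_structure B & isf_coherent_EPPA_witness Gam A B) /\
  ((forall A : structure L,
      finite_structure A -> finite_set (relabel_orbit Gam A)) ->
   has_isf_coherent_EPPA Gam (@finite_structure L)).
Proof.
have main (A : structure L) : finite_structure A ->
    finite_set (relabel_orbit Gam A) ->
    exists2 B : structure L, finite_structure B & isf_coherent_EPPA_witness Gam A B.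
  move: A; apply: finite_structure_finType => T S orb.
  have [K [rho [rhoM rho_surj rho_relabel]]] :=
    @finite_orbit_quotient (lang_perm L) Gam {classic structure_on L T}
      (@relabel L T) S (@relabel1 L T) (@relabelM L T) orb.
  have C := @clique_cover_exists ({perm T} * K)%type T fst (fun _ _ => erefl)
    (local_type Gam S rho).
  exists (glued unaryL C); first exact: finite_finset.
  exists (Embedding (base_map_embedding unaryL rhoM rho_relabel C)).
  have coh := glued_coherent unaryL rhoM rho_relabel C.
  split=> //; first exact: coherent_EPPA.
  exact: glued_faithful.
split=> // orb A finA; exact: main (orb A finA).
Qed.
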